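(* Let $R$ be a commutative ring, let $P_0$ be a finitely generated projective $R$-module of constant rank $2$ and let $\theta_0:R\xrightarrow{\cong}\det(P_0)$ be a trivialization of its determinant. Let $\varphi\in SL(P_0\oplus R)$ and $a\in Um(P_0\oplus R)$. Then $V(a)=V(a\varphi)$ in $\tilde V_{SL}(R)$. In particular, $a\mapsto V(a)$ induces a well-defined map $V:Um(P_0\oplus R)/SL(P_0\oplus R)\to\tilde V_{SL}(R)$ (the generalized Vaserstein symbol modulo $SL$).
   Context: For a finitely generated projective $R$-module $P$: $P^{\vee}=\mathrm{Hom}_R(P,R)$; $Um(P)$ is the set of epimorphisms $P\to R$; $SL(P)$ is the group of automorphisms of determinant $1$, acting on the right on $Um(P)$ by precomposition. An alternating isomorphism on $P$ is an isomorphism $f:P\to P^{\vee}$ with $f(p)(p)=0$ for all $p$; this is the same as a non-degenerate alternating form on $P$, and for a homomorphism $h:Q\to P$ the pulled-back form is written $h^{\vee}fh=h^tfh$. Triples $(P,f_0,f_1)$, $(P',f_0',f_1')$ with alternating isomorphisms $f_i$ on $P$, $f'_i$ on $P'$ are isometric if there is an isomorphism $h:P\to P'$ with $f_i=h^{\vee}f_i'h$, $i=0,1$; $[P,f_0,f_1]$ is the isometry class. $V(R)$ is the quotient of the free abelian group on isometry classes of triples by the relations (1) $[P\oplus P',g\perp g',f\perp f']=[P,g,f]+[P',g',f']$ and (2) $[P,f_0,f_1]+[P,f_1,f_2]=[P,f_0,f_2]$. $V_{SL}(R)$ is the quotient of the same free abelian group by (1), (2) and (3) $[P,g,f]=[P,g,\varphi^{\vee}f\varphi]$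 for $\varphi\in SL(P)$. Let $A_{2n}(R)$ be the set of invertible alternating $2n\times2n$ matrices, $\psi_2=\begin{pmatrix}0&1\\-1&0\end{pmatrix}$, $\psi_{2n+2}=\psi_{2n}\perp\psi_2$, $A(R)=\mathrm{colim}_n A_{2n}(R)$ along $M\mapsto M\perp\psi_2$. For a group $G$ with $E(R)\subset G\subset SL(R)$ write $M\sim_GN$ ($M\in A_{2m}(R)$, $N\in A_{2n}(R)$) if $M\perp\psi_{2n+2s}=E^t(N\perp\psi_{2m+2s})E$ for some $s\in\mathbb N$ and $E\in SL_{2m+2n+2s}(R)\cap G$. $W'_G(R)=A(R)/{\sim_G}$ is an abelian group under $\perp$, and $W_G(R)$ is the kernel of the Pfaffian $W'_G(R)\to R^{\times}$; write $W_E$, $W_{SL}$ for $G=E(R)$, $SL(R)$. The assignment $M\mapsto[R^{2m},\psi_{2m},M]$ induces isomorphisms $W'_E(R)\cong V(R)$ and $W'_{SL}(R)\cong V_{SL}(R)$; $\tilde V(R)$ and $\tilde V_{SL}(R)$ are the subgroups corresponding to $W_E(R)$ and $W_{SL}(R)$. There is a canonical epimorphism $\tilde V(R)\to\tilde V_{SL}(R)$. Generalized Vaserstein symbol: let $\chi_0$ be the form $\chi_0(p,q)=\theta_0^{-1}(p\wedge q)$ on $P_0$. For $a\in Um(P_0\oplus R)$ put $P(a)=\ker a$, choose a section $s:R\to P_0\oplus R$ of $a$, and let $i_s:P_0\oplus R\to P(a)\oplus R$, $i_s(p)=(p-s(a(p)),a(p))$. The exact sequence $0\to P(a)\to P_0\oplus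 R\xrightarrow{a}R\to0$ gives an isomorphism $\det(P_0)\cong\det(P(a))$ independent of $s$ (through $\det(P_0)\cong\det(P_0\oplus R)$, $x\wedge y\mapsto x\wedge y\wedge(0,1)$, and $\det(P(a))\cong\det(P_0\oplus R)$, $p\wedge q\mapsto p\wedge q\wedge s(1)$); composing with $\theta_0$ yields $\theta:R\xrightarrow{\cong}\det(P(a))$. Put $\chi_a(p,q)=\theta^{-1}(p\wedge q)$ on $P(a)$ and $V(a,s)=(i_s\oplus1)^t(\chi_a\perp\psi_2)(i_s\oplus1)$, a non-degenerate alternating form on $P_0\oplus R^2$. It is known that $[P_0\oplus R^2,\chi_0\perp\psi_2,V(a,s)]$ lies in $\tilde V(R)$ and is independent of $s$; $V(a)$ denotes its image in $\tilde V_{SL}(R)$. *)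

(* Defs.v *)
From HB Require Import structures.
From mathcomp Require Import all_boot all_order all_algebra.
From mathcomp Require Import ring boolp.

Set Implicit Arguments.
Unset Strict Implicit.
Unset Printing Implicit Defensive.

Import GRing.Theory.
Local Open Scope ring_scope.
Local Open Scope quotient_scope.

(* A formal A-linear combination of elements of G is a list of pairs          *)
(* (coefficient, generator).                                                  *)
Definition fscale {A : pzRingType} {G : Type} (c : A) (s : seq (A * G)) :
    seq (A * G) :=
  [seq (c * x.1, x.2) | x <- s].

(* [pres rel] is the congruence on formal combinations whose quotient is the  *)
(* free left A-module on G modulo the submodule generated by the s - t with   *)
(* [rel s t]; concatenation induces the addition.  For A = int this is the    *)
(* free abelian group on G modulo the relations.                              *)
Inductive pres {A : pzRingType} {G : Type}
    (rel : seq (A * G) -> seq (A * G) -> Prop) :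
    seq (A * G) -> seq (A * G) -> Prop :=
| pres_refl s : pres rel s s
| pres_sym s t : pres rel s t -> pres rel t s
| pres_trans s t u : pres rel s t -> pres rel t u -> pres rel s u
| pres_cat s s' t t' :
    pres rel s s' -> pres rel t t' -> pres rel (s ++ t) (s' ++ t')
| pres_catC s t : pres rel (s ++ t) (t ++ s)
| pres_merge c d g : pres rel [:: (c + d, g)] [:: (c, g); (d, g)]
| pres_zero g : pres rel [:: (0, g)] [::]
| pres_rel c s t : rel s t -> pres rel (fscale c s) (fscale c t).

Lemma fscaleA (A : pzRingType) (G : Type) (c d : A) (s : seq (A * G)) :
  fscale c (fscale d s) = fscale (c * d) s.
Proof. by rewrite /fscale -map_comp; apply: eq_map => x /=; rewrite mulrA. Qed.

Lemma fscale1 (A : pzRingType) (G : Type) (s : seq (A * G)) : fscale 1 s = s.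
Proof.
by rewrite -[RHS]map_id; apply: eq_map => -[c g] /=; rewrite mul1r.
Qed.

Lemma pres_fscale (A : pzRingType) (G : Type)
    (rel : seq (A * G) -> seq (A * G) -> Prop) (c : A) s t :
  pres rel s t -> pres rel (fscale c s) (fscale c t).
Proof.
elim=> {s t}.
- by move=> s; apply: pres_refl.
- by move=> s t _; apply: pres_sym.
- by move=> s t u _ IH1 _; apply: pres_trans.
- by move=> s s' t t' _ IH1 _ IH2; rewrite /fscale !map_cat; apply: pres_cat.
- by move=> s t; rewrite /fscale !map_cat; apply: pres_catC.
- by move=> x y g; rewrite /fscale /= mulrDr; apply: pres_merge.
- by move=> g; rewrite /fscale /= mulr0; apply: pres_zero.
- by move=> d s t st; rewrite !fscaleA; apply: pres_rel.
Qed.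

Lemma pres_fscale0 (A : pzRingType) (G : Type)
    (rel : seq (A * G) -> seq (A * G) -> Prop) s :
  pres rel (fscale 0 s) [::].
Proof.
elim: s => [|x s IH]; first exact: pres_refl.
rewrite -[[::]]cat0s -[fscale 0 (x :: s)]/([:: (0 * x.1, x.2)] ++ fscale 0 s).
by apply: pres_cat => //; rewrite mul0r; apply: pres_zero.
Qed.

Lemma pres_fscaleD (A : pzRingType) (G : Type)
    (rel : seq (A * G) -> seq (A * G) -> Prop) c d s :
  pres rel (fscale (c + d) s) (fscale c s ++ fscale d s).
Proof.
elim: s => [|x s IH]; first exact: pres_refl.
pose x1 z : seq (A * G) := [:: (z * x.1, x.2)].
rewrite -[fscale (c + d) _]/(x1 (c + d) ++ fscale (c + d) s).
apply: pres_trans (pres_cat (pres_refl _ _) IH) _.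
rewrite -[fscale c (x :: s)]/(x1 c ++ fscale c s).
rewrite -[fscale d (x :: s)]/(x1 d ++ fscale d s).
apply: (@pres_trans _ _ _ _ ((x1 c ++ x1 d) ++ (fscale c s ++ fscale d s))).
  apply: pres_cat; last exact: pres_refl.
  by rewrite /x1 mulrDl; apply: pres_merge.
rewrite -!catA; apply: pres_cat; first exact: pres_refl.
rewrite !catA; apply: pres_cat; last exact: pres_refl.
exact: pres_catC.
Qed.

Definition mk_linear {R : comPzRingType} {U V : lmodType R} (f : U -> V)
    (lin_f : linear f) : {linear U -> V} :=
  HB.pack f (GRing.isLinear.Build R U V *:%R f lin_f).

Definition mk_scalar {R : comPzRingType} {U : lmodType R} (f : U -> R)
    (lin_f : scalar f) : {scalar U} :=
  HB.pack f (GRing.isLinear.Build R U R *%R f lin_f).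

Section Kernel.
Context {R : comPzRingType} {N : lmodType R} (a : {scalar N}).

Definition ker_pred : {pred N} := fun x => a x == 0.

Fact ker_submod_closed : submod_closed ker_pred.
Proof.
split; first by rewrite unfold_in linear0.
move=> c u v; rewrite !unfold_in => /eqP au /eqP av.
by rewrite linearP /= au av mulr0 addr0.
Qed.

HB.instance Definition _ :=
  GRing.isSubmodClosed.Build R N ker_pred ker_submod_closed.

Record ker := Ker { ker_val : N; ker_valP : ker_val \in ker_pred }.

HB.instance Definition _ := [isSub for ker_val].
HB.instance Definition _ := [Choice of ker by <:].
HB.instance Definition _ := [SubChoice_isSubLmodule of ker by <:].

Fact ker_val_is_linear : linear ker_val.
Proof. by move=> c u v; rewrite -[ker_val]/(val) linearP. Qed.

Definition ker_incl : {linear ker -> N} := mk_linear ker_val_is_linear.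
End Kernel.

Fact inl_is_linear (R : comPzRingType) (P Q : lmodType R) :
  linear (fun p : P => (p, 0) : (P * Q)%type).
Proof.
by move=> c u v; rewrite -[RHS]/(c *: u + v, c *: 0 + 0) scaler0 addr0.
Qed.

Definition inl_lin {R : comPzRingType} (P Q : lmodType R) :
    {linear P -> (P * Q)%type} :=
  mk_linear (@inl_is_linear R P Q).

Section Exterior.
Context {R : comPzRingType} (k : nat) (M : lmodType R).

Definition upd (m : {ffun 'I_k -> M}) (i : 'I_k) (x : M) : {ffun 'I_k -> M} :=
  [ffun j => if j == i then x else m j].

Inductive ext_rel :
    seq (R * {ffun 'I_k -> M}) -> seq (R * {ffun 'I_k -> M}) -> Prop :=
| ext_linear m i a x y :
    ext_rel [:: (1, upd m i (a *: x + y))]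
            [:: (a, upd m i x); (1, upd m i y)]
| ext_alternating (m : {ffun 'I_k -> M}) i j :
    i != j -> m i = m j -> ext_rel [:: (1, m)] [::].

Definition ext_eq (s t : seq (R * {ffun 'I_k -> M})) : bool :=
  `[< pres ext_rel s t >].

Fact ext_eq_refl : reflexive ext_eq.
Proof. by move=> s; apply/asboolP/pres_refl. Qed.

Fact ext_eq_sym : symmetric ext_eq.
Proof. by move=> s t; apply/asboolP/asboolP; apply: pres_sym. Qed.

Fact ext_eq_trans : transitive ext_eq.
Proof.
move=> t s u /asboolP st /asboolP tu; apply/asboolP.
exact: pres_trans st tu.
Qed.

Canonical ext_equiv := EquivRel ext_eq ext_eq_refl ext_eq_sym ext_eq_trans.

Definition ext := {eq_quot ext_equiv}.

HB.instance Definition _ := Choice.on ext.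
HB.instance Definition _ := EqQuotient.on ext.

Lemma ext_piP (s t : seq (R * {ffun 'I_k -> M})) :
  \pi_ext s = \pi_ext t <-> pres ext_rel s t.
Proof.
split=> [/eqmodP/asboolP //|st].
by apply/eqmodP/asboolP.
Qed.

Lemma ext_reprK (s : seq (R * {ffun 'I_k -> M})) :
  pres ext_rel (repr (\pi_ext s)) s.
Proof. by apply/ext_piP; rewrite reprK. Qed.

Definition ext_add (u v : ext) : ext := \pi_ext (repr u ++ repr v).
Definition ext_scale (c : R) (u : ext) : ext := \pi_ext (fscale c (repr u)).

Lemma ext_addE s t : ext_add (\pi_ext s) (\pi_ext t) = \pi_ext (s ++ t).
Proof. by apply/ext_piP; apply: pres_cat; apply: ext_reprK. Qed.

Lemma ext_scaleE c s : ext_scale c (\pi_ext s) = \pi_ext (fscale c s).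
Proof. by apply/ext_piP; apply: pres_fscale; apply: ext_reprK. Qed.

Lemma ext_surj (u : ext) : exists s, u = \pi_ext s.
Proof. by exists (repr u); rewrite reprK. Qed.

Fact ext_addA : associative ext_add.
Proof.
move=> u v w; have [s ->] := ext_surj u; have [t ->] := ext_surj v.
by have [r ->] := ext_surj w; rewrite !ext_addE catA.
Qed.

Fact ext_addC : commutative ext_add.
Proof.
move=> u v; have [s ->] := ext_surj u; have [t ->] := ext_surj v.
by rewrite !ext_addE; apply/ext_piP/pres_catC.
Qed.

Fact ext_add0 : left_id (\pi_ext [::]) ext_add.
Proof. by move=> u; have [s ->] := ext_surj u; rewrite ext_addE. Qed.

Fact ext_addN : left_inverse (\pi_ext [::]) (ext_scale (-1)) ext_add.
Proof.
move=> u; have [s ->] := ext_surj u; rewrite ext_scaleE ext_addE.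
apply/ext_piP; rewrite -[X in _ ++ X]fscale1.
apply: pres_trans (pres_fscale0 _ s).
by rewrite -(addNr 1); apply/pres_sym/pres_fscaleD.
Qed.

HB.instance Definition _ :=
  GRing.isZmodule.Build ext ext_addA ext_addC ext_add0 ext_addN.

Fact ext_scaleA a b u : ext_scale a (ext_scale b u) = ext_scale (a * b) u.
Proof. by have [s ->] := ext_surj u; rewrite !ext_scaleE fscaleA. Qed.

Fact ext_scale1 : left_id 1 ext_scale.
Proof. by move=> u; have [s ->] := ext_surj u; rewrite ext_scaleE fscale1. Qed.

Fact ext_scaleDr : right_distributive ext_scale +%R.
Proof.
move=> c u v; have [s ->] := ext_surj u; have [t ->] := ext_surj v.
rewrite -[_ + _ in LHS]/(ext_add _ _) -[RHS]/(ext_add _ _).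
by rewrite ext_addE !ext_scaleE ext_addE /fscale map_cat.
Qed.

Fact ext_scaleDl u : {morph ext_scale^~ u : a b / a + b}.
Proof.
have [s ->] := ext_surj u => a b; rewrite -[RHS]/(ext_add _ _) !ext_scaleE.
by rewrite ext_addE; apply/ext_piP/pres_fscaleD.
Qed.

HB.instance Definition _ :=
  GRing.Zmodule_isLmodule.Build R ext
    ext_scaleA ext_scale1 ext_scaleDr ext_scaleDl.

Definition wedge (m : {ffun 'I_k -> M}) : ext := \pi_ext [:: (1, m)].

Definition multilinear_map (N : lmodType R) (f : {ffun 'I_k -> M} -> N) :=
  forall m i a x y,
    f (upd m i (a *: x + y)) = a *: f (upd m i x) + f (upd m i y).

Definition alternating_map (N : lmodType R) (f : {ffun 'I_k -> M} -> N) :=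
  forall (m : {ffun 'I_k -> M}) i j, i != j -> m i = m j -> f m = 0.

Lemma wedge_multilinear : multilinear_map wedge.
Proof.
move=> m i a x y.
rewrite -[RHS]/(ext_add (ext_scale a (wedge _)) (wedge _)) /wedge.
rewrite ext_scaleE ext_addE /fscale /= mulr1; apply/ext_piP.
have := pres_rel 1 (ext_linear m i a x y).
by rewrite !fscale1.
Qed.

Lemma wedge_alternating : alternating_map wedge.
Proof.
move=> m i j ij mij; apply/ext_piP.
by have := pres_rel 1 (ext_alternating ij mij); rewrite !fscale1.
Qed.

Section Lift.
Context (N : lmodType R) (f : {ffun 'I_k -> M} -> N).
Context (f_lin : multilinear_map f) (f_alt : alternating_map f).

Definition ext_eval (s : seq (R * {ffun 'I_k -> M})) : N :=
  \sum_(x <- s) x.1 *: f x.2.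

Lemma ext_eval_scale c s : ext_eval (fscale c s) = c *: ext_eval s.
Proof.
rewrite /ext_eval /fscale big_map scaler_sumr.
by apply: eq_bigr => x _ /=; rewrite scalerA.
Qed.

Lemma ext_eval_pres s t : pres ext_rel s t -> ext_eval s = ext_eval t.
Proof.
elim=> {s t} //.
- by move=> s t u _ -> _ ->.
- by move=> s s' t t' _ IH1 _ IH2; rewrite /ext_eval !big_cat /=; congr (_ + _).
- by move=> s t; rewrite /ext_eval !big_cat /= addrC.
- by move=> c d g; rewrite /ext_eval !big_cons !big_nil /= !addr0 scalerDl.
- by move=> g; rewrite /ext_eval !big_cons !big_nil /= scale0r addr0.
- move=> c s t st; rewrite !ext_eval_scale; congr (_ *: _).
  case: st => [m i a x y|m i j ij mij]; rewrite /ext_eval.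
    by rewrite !big_cons !big_nil /= !addr0 !scale1r f_lin.
  by rewrite !big_cons !big_nil /= (f_alt ij mij) scaler0 addr0.
Qed.

Definition ext_lift_fun (u : ext) : N := ext_eval (repr u).

Lemma ext_lift_pi s : ext_lift_fun (\pi_ext s) = ext_eval s.
Proof. exact/ext_eval_pres/ext_reprK. Qed.

Fact ext_lift_is_linear : linear ext_lift_fun.
Proof.
move=> c u v; have [s ->] := ext_surj u; have [t ->] := ext_surj v.
rewrite -[c *: _ + _]/(ext_add (ext_scale c _) _) ext_scaleE ext_addE.
by rewrite !ext_lift_pi -ext_eval_scale /ext_eval big_cat.
Qed.

Definition ext_lift : {linear ext -> N} := mk_linear ext_lift_is_linear.

Lemma ext_lift_wedge m : ext_lift (wedge m) = f m.
Proof.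
rewrite -[LHS]/(ext_lift_fun _) ext_lift_pi /ext_eval.
by rewrite big_cons big_nil /= addr0 scale1r.
Qed.
End Lift.

Lemma ext_ind (Q : ext -> Prop) :
  (forall c m u, Q u -> Q (c *: wedge m + u)) -> Q 0 -> forall u, Q u.
Proof.
move=> QD Q0 u; have [s ->] := ext_surj u.
elim: s => [|[c m] s IH]; first exact: Q0.
suff -> : \pi_ext ((c, m) :: s) = c *: wedge m + \pi_ext s by exact: QD.
rewrite -[RHS]/(ext_add (ext_scale c _) _) ext_scaleE ext_addE /fscale /=.
by rewrite mulr1.
Qed.
End Exterior.

Arguments wedge {R k M} m.

Definition wedge2 {R : comPzRingType} {M : lmodType R} (x y : M) : ext 2 M :=
  wedge [ffun i : 'I_2 => [:: x; y]`_i].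

Section WedgeWith.
Context {R : comPzRingType} (k : nat) (M N : lmodType R).
Context (g : {linear M -> N}) (n : N).

Definition ffun_rcons (m : {ffun 'I_k -> M}) : {ffun 'I_k.+1 -> N} :=
  [ffun i => if unlift ord_max i is Some j then g (m j) else n].

Lemma ffun_rcons_upd m i x :
  ffun_rcons (upd m i x) = upd (ffun_rcons m) (lift ord_max i) (g x).
Proof.
apply/ffunP => j; rewrite !ffunE; case: unliftP => [j' ->|->].
  by rewrite ffunE (inj_eq lift_inj); case: eqP.
by rewrite (negbTE (neq_lift _ _)).
Qed.

Fact wedge_with_multilinear :
  multilinear_map (fun m => wedge (ffun_rcons m) : ext k.+1 N).
Proof.
by move=> m i a x y; rewrite !ffun_rcons_upd linearP wedge_multilinear.
Qed.

Fact wedge_with_alternating :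
  alternating_map (fun m => wedge (ffun_rcons m) : ext k.+1 N).
Proof.
move=> m i j ij mij.
apply: (@wedge_alternating _ _ _ _ (lift ord_max i) (lift ord_max j)).
  by rewrite (inj_eq lift_inj).
by rewrite !ffunE !liftK mij.
Qed.

(* m_1 /\ ... /\ m_k  |->  g m_1 /\ ... /\ g m_k /\ n *)
Definition wedge_with : {linear ext k M -> ext k.+1 N} :=
  ext_lift wedge_with_multilinear wedge_with_alternating.
End WedgeWith.

Arguments wedge_with {R} k {M N} g n.

Definition finitely_generated {R : comPzRingType} (P : lmodType R) : Prop :=
  exists (n : nat) (g : {linear 'cV[R]_n -> P}), forall p, exists v, g v = p.

Definition projective {R : comPzRingType} (P : lmodType R) : Prop :=
  forall (M N : lmodType R) (g : {linear M -> N}) (f : {linear P -> N}),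
    (forall y, exists x, g x = y) ->
    exists h : {linear P -> M}, forall p, g (h p) = f p.

Definition fg_projective {R : comPzRingType} (P : lmodType R) : Prop :=
  finitely_generated P /\ projective P.

Definition prime_ideal {R : comPzRingType} (I : R -> Prop) : Prop :=
  [/\ I 0, ~ I 1, (forall a u v, I u -> I v -> I (a * u + v))
    & (forall u v, I (u * v) -> I u \/ I v)].

(* The localization of P at the prime ideal I is free of rank n.  A basis of  *)
(* the localization can be rescaled to consist of fractions b_i / 1; the two  *)
(* clauses say that these generate the localization and that they are         *)
(* linearly independent over the localization of R.                           *)
Definition free_at {R : comPzRingType} (n : nat) (P : lmodType R)
    (I : R -> Prop) : Prop :=
  exists b : 'I_n -> P,
    (forall p, exists s, ~ I s /\
       exists c : 'I_n -> R, s *: p = \sum_i c i *: b i)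
    /\ (forall c : 'I_n -> R, \sum_i c i *: b i = 0 ->
          exists s, ~ I s /\ forall i, s * c i = 0).

Definition constant_rank {R : comPzRingType} (n : nat) (P : lmodType R) : Prop :=
  forall I : R -> Prop, prime_ideal I -> free_at n P I.

(* The determinant of an endomorphism phi of a finitely generated projective  *)
(* module P (of possibly non-constant rank): embed P as a direct summand      *)
(* P (+) Q = R^n and take the determinant of the matrix of phi (+) id_Q; the  *)
(* result depends neither on Q nor on the isomorphism.  Here i and r are the  *)
(* inclusion and the projection of the summand, and phi (+) id_Q is           *)
(* v |-> i (phi (r v)) + (v - i (r v)).                                       *)
Definition is_det {R : comPzRingType} (P : lmodType R) (phi : P -> P) (d : R) :
    Prop :=
  exists (n : nat) (i : {linear P -> 'cV[R]_n}) (r : {linear 'cV[R]_n -> P}),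
    cancel i r /\
    d = \det (\matrix_(k, l)
          (let v : 'cV[R]_n := delta_mx l 0 in
           i (phi (r v)) + (v - i (r v))) k 0).

Record SL {R : comPzRingType} (P : lmodType R) := MkSL {
  SL_fun :> {linear P -> P};
  SL_bij : bijective SL_fun;
  SL_det : is_det SL_fun 1 }.

Record Um {R : comPzRingType} (P : lmodType R) := MkUm {
  Um_fun :> {scalar P};
  Um_surj : forall r, exists p, Um_fun p = r }.

Section UmAct.
Context {R : comPzRingType} {P : lmodType R} (a : Um P) (phi : SL P).

Fact Um_act_is_scalar : scalar (fun p => a (phi p)).
Proof. by move=> c u v; rewrite !linearP. Qed.

Fact Um_act_surj r : exists p, mk_scalar Um_act_is_scalar p = r.
Proof.
have [p <-] := Um_surj a r; have [psi phiK psiK] := SL_bij phi.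
by exists (psi p); rewrite /= psiK.
Qed.

Definition Um_act : Um P := MkUm Um_act_surj.
End UmAct.

Definition Um_orbit {R : comPzRingType} {P : lmodType R} (a b : Um P) : Prop :=
  exists phi : SL P, b = Um_act a phi.

Definition Um_mod_SL {R : comPzRingType} (P : lmodType R) : Type :=
  {O : Um P -> Prop | exists a, O = Um_orbit a}.

Definition Um_class {R : comPzRingType} {P : lmodType R} (a : Um P) :
    Um_mod_SL P :=
  exist _ (Um_orbit a) (ex_intro _ a erefl).

(* Non-degeneracy: p |-> form p _ is a bijection onto the dual {scalar P}. *)
Record altform {R : comPzRingType} (P : lmodType R) := AltForm {
  form :> P -> P -> R;
  form_linearl : forall q, scalar (form^~ q);
  form_linearr : forall p, scalar (form p);
  form_alt : forall p, form p p = 0;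
  form_nondeg : forall g : {scalar P}, exists! p, forall q, form p q = g q }.

Section Perp.
Context {R : comPzRingType} {P Q : lmodType R} (f : altform P) (g : altform Q).

Definition perp_fun (x y : (P * Q)%type) : R := f x.1 y.1 + g x.2 y.2.

Fact perp_linearl y : scalar (perp_fun^~ y).
Proof.
by move=> c u v; rewrite /perp_fun /= form_linearl form_linearl mulrDr addrACA.
Qed.

Fact perp_linearr x : scalar (perp_fun x).
Proof.
by move=> c u v; rewrite /perp_fun /= form_linearr form_linearr mulrDr addrACA.
Qed.

Fact perp_alt x : perp_fun x x = 0.
Proof. by rewrite /perp_fun !form_alt addr0. Qed.

Fact perp_nondeg (h : {scalar (P * Q)%type}) :
  exists! x, forall y, perp_fun x y = h y.
Proof.
have l1 : scalar (fun p : P => h (p, 0)).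
  by move=> c u v; rewrite -linearP (inl_is_linear Q c u v).
have l2 : scalar (fun q : Q => h (0, q)).
  move=> c u v; rewrite -linearP; congr (h _).
  by rewrite -[RHS]/(c *: 0 + 0, c *: u + v) scaler0 addr0.
have [p [hp Up]] := form_nondeg f (mk_scalar l1).
have [q [hq Uq]] := form_nondeg g (mk_scalar l2).
have f0 x : f x 0 = 0 := linear0 (mk_scalar (form_linearr f x)).
have g0 x : g x 0 = 0 := linear0 (mk_scalar (form_linearr g x)).
exists (p, q); split=> [[y1 y2]|[p' q'] h'].
  rewrite /perp_fun /= hp hq /= -[h (y1, 0)]mul1r -linearP; congr (h _).
  by rewrite -[LHS]/(1 *: y1 + 0, 1 *: 0 + y2) !scale1r addr0 add0r.
congr (_, _); [apply: Up|apply: Uq] => y /=.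
  by rewrite -h' /perp_fun /= g0 addr0.
by rewrite -h' /perp_fun /= f0 add0r.
Qed.

Definition perp : altform (P * Q)%type :=
  AltForm perp_linearl perp_linearr perp_alt perp_nondeg.
End Perp.

Section Pullback.
Context {R : comPzRingType} {P Q : lmodType R}.
Context (h : {linear P -> Q}) (hB : bijective h) (f : altform Q).

Fact pullback_linearl y : scalar (fun x => f (h x) (h y)).
Proof. by move=> c u v; rewrite linearP form_linearl. Qed.

Fact pullback_linearr x : scalar (fun y => f (h x) (h y)).
Proof. by move=> c u v; rewrite linearP form_linearr. Qed.

Fact pullback_alt x : f (h x) (h x) = 0.
Proof. exact: form_alt. Qed.

Fact pullback_nondeg (g : {scalar P}) :
  exists! x, forall y, f (h x) (h y) = g y.
Proof.
have [h' hK h'K] := hB.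
have l : scalar (fun q => g (h' q)).
  move=> c u v; rewrite -linearP; congr (g _).
  by rewrite -[u in LHS]h'K -[v in LHS]h'K -linearP hK.
have [q [hq Uq]] := form_nondeg f (mk_scalar l).
exists (h' q); split=> [y|x hx]; first by rewrite h'K hq /= hK.
by rewrite -[RHS]hK; congr h'; apply: Uq => y; rewrite -[y]h'K hx /= hK.
Qed.

(* h^t f h *)
Definition pullback : altform P :=
  AltForm pullback_linearl pullback_linearr pullback_alt pullback_nondeg.
End Pullback.

Section MatrixForm.
Context {R : comPzRingType}.

Definition alternating_mx (n : nat) (M : 'M[R]_n) : Prop :=
  M^T = - M /\ forall i, M i i = 0.

Definition invertible_mx (n : nat) (M : 'M[R]_n) : Prop :=
  exists N, M *m N = 1%:M /\ N *m M = 1%:M.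

Record altmx (n : nat) := AltMx {
  altmx_val :> 'M[R]_(n.*2);
  altmx_alt : alternating_mx altmx_val;
  altmx_inv : invertible_mx altmx_val }.

Section Form.
Context (n : nat) (M : altmx n).

Definition mxform_fun (x y : 'cV[R]_(n.*2)) : R := (x^T *m M *m y) 0 0.

Fact mxform_linearl y : scalar (mxform_fun^~ y).
Proof.
move=> c u v; rewrite /mxform_fun linearP /= !mulmxDl -!scalemxAl.
by rewrite [LHS]mxE [X in X + _]mxE.
Qed.

Fact mxform_linearr x : scalar (mxform_fun x).
Proof.
move=> c u v; rewrite /mxform_fun mulmxDr -scalemxAr.
by rewrite [LHS]mxE [X in X + _]mxE.
Qed.

Fact mxform_alt x : mxform_fun x x = 0.
Proof.
have [MT M0] := altmx_alt M.
have Mc i j : M i j = - M j i.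
  by have /matrixP/(_ j i) := MT; rewrite !mxE.
rewrite /mxform_fun -mulmxA mxE.
under eq_bigr => i _ do rewrite !mxE big_distrr /=.
pose F (i j : 'I_(n.*2)) := x i 0 * (M i j * x j 0).
rewrite -[LHS]/(\sum_i \sum_j F i j).
have Fc i j : F i j = - F j i by rewrite /F Mc; ring.
have F0 i : F i i = 0 by rewrite /F M0 mul0r mulr0.
have split3 i : \sum_j F i j = \sum_(j : 'I_(n.*2) | (i < j)%N) F i j
                              + \sum_(j : 'I_(n.*2) | (j < i)%N) F i j.
  rewrite (bigID (fun j : 'I_(n.*2) => (i < j)%N)) /=; congr (_ + _).
  rewrite (bigID (fun j : 'I_(n.*2) => (j < i)%N)) /= [X in _ + X]big1 ?addr0.
    by apply: eq_bigl => j; case: ltngtP.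
  by move=> j /andP[ij ji]; have -> : i = j; [apply/val_inj; case: ltngtP ij ji|].
rewrite (eq_bigr _ (fun i _ => split3 i)) big_split /=.
rewrite [X in _ + X](exchange_big_dep xpredT) //= -big_split big1 // => i _.
by rewrite -big_split big1 //= => j _; rewrite [F j i]Fc subrr.
Qed.

Fact mxform_nondeg (g : {scalar 'cV[R]_(n.*2)}) :
  exists! x, forall y, mxform_fun x y = g y.
Proof.
have [N [MN NM]] := altmx_inv M.
pose w : 'rV[R]_(n.*2) := \row_l g (delta_mx l 0).
have gE y : g y = (w *m y) 0 0.
  rewrite {1}[y]matrix_sum_delta linear_sum mxE; apply: eq_bigr => l _ /=.
  by rewrite big_ord1 -[_ *: _]addr0 linearP linear0 addr0 mxE mulrC.
exists (w *m N)^T; split=> [y|x hx].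
  by rewrite /mxform_fun trmxK -[w *m N *m M]mulmxA NM mulmx1 gE.
apply: trmx_inj; rewrite trmxK.
suff -> : w = x^T *m M by rewrite -mulmxA MN mulmx1.
apply/rowP => l; rewrite mxE -hx /mxform_fun.
by rewrite -colE mxE.
Qed.

Definition mxform : altform 'cV[R]_(n.*2) :=
  AltForm mxform_linearl mxform_linearr mxform_alt mxform_nondeg.
End Form.

Definition psi2_mx : 'M[R]_2 :=
  \matrix_(i, j) ((i < j)%:R - (j < i)%:R).

(* All diagonal blocks are equal, so the new block may be put first: this     *)
(* makes the size 2 + n.*2 convertible to n.+1.*2.                            *)
Fixpoint psi_mx (n : nat) : 'M[R]_(n.*2) :=
  if n is n'.+1 then block_mx psi2_mx 0 0 (psi_mx n') : 'M_(2 + n'.*2) else 0.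

Lemma psi2_sqr : psi2_mx *m psi2_mx = - 1%:M.
Proof.
apply/matrixP => i j; rewrite !mxE big_ord_recl big_ord1 !mxE.
by case: (unliftP ord0 i) => [i' ->|->]; case: (unliftP ord0 j) => [j' ->|->];
  rewrite ?ord1 /=; ring.
Qed.

Lemma psi_sqr n : psi_mx n *m psi_mx n = - 1%:M.
Proof.
elim: n => [|n IH]; first by apply/matrixP => -[].
rewrite /= -[n.+1.*2]/(2 + n.*2)%N mulmx_block !mulmx0 !mul0mx !addr0 add0r.
by rewrite psi2_sqr IH [in RHS]scalar_mx_block opp_block_mx !oppr0.
Qed.

Lemma psi_alternating n : alternating_mx (psi_mx n).
Proof.
elim: n => [|n [IHt IHd]]; first by split=> [|[]//]; apply/matrixP => -[].
rewrite /= -[n.+1.*2]/(2 + n.*2)%N; split.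
  rewrite tr_block_mx !trmx0 IHt opp_block_mx !oppr0; congr block_mx.
  by apply/matrixP => i j; rewrite !mxE opprB.
move=> i; rewrite -[i]splitK; case: (split i) => j /=.
  by rewrite block_mxEul mxE subrr.
by rewrite block_mxEdr.
Qed.

Lemma psi_invertible n : invertible_mx (psi_mx n).
Proof.
by exists (- psi_mx n); rewrite mulmxN mulNmx psi_sqr opprK.
Qed.

Definition psi n : altmx n := AltMx (psi_alternating n) (psi_invertible n).

(* Expansion along the first row; the sign is normalized by pfaffian psi = 1. *)
Fixpoint pfaffian (n : nat) : 'M[R]_(n.*2) -> R :=
  match n with
  | 0 => fun _ => 1
  | n'.+1 => fun M : 'M[R]_(n'.*2.+2) =>
      \sum_(j < n'.*2.+1) (-1) ^+ j * M ord0 (lift ord0 j) *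
        pfaffian (mxsub (fun k => lift ord0 (lift j k))
                        (fun k => lift ord0 (lift j k)) M)
  end.

Lemma pfaffian_psi n : pfaffian (psi_mx n) = 1.
Proof.
elim: n => [//|n IH].
pose B : 'M[R]_(2 + n.*2) := block_mx psi2_mx 0 0 (psi_mx n).
have dr i j : B (rshift 2 i) (rshift 2 j) = psi_mx n i j.
  exact: block_mxEdr.
have ur i j : B (lshift _ i) (rshift 2 j) = 0 by rewrite block_mxEur mxE.
have ul i j : B (lshift _ i) (lshift _ j) = psi2_mx i j by exact: block_mxEul.
have rE (k : 'I_(n.*2)) : lift ord0 (lift ord0 k) = rshift 2 k by exact/val_inj.
have e0 : (ord0 : 'I_(n.*2.+2)) = lshift (n.*2) (ord0 : 'I_2) by exact/val_inj.
have e1 : lift ord0 (ord0 : 'I_(n.*2.+1)) = lshift (n.*2) (ord_max : 'I_2).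
  exact/val_inj.
rewrite -[LHS]/(\sum_(j < n.*2.+1) (-1) ^+ j * B ord0 (lift ord0 j) *
  pfaffian (mxsub (fun k => lift ord0 (lift j k))
                  (fun k => lift ord0 (lift j k)) B)).
rewrite big_ord_recl big1 => [|j _].
  have -> : mxsub (fun k => lift ord0 (lift ord0 k))
      (fun k => lift ord0 (lift ord0 k)) B = psi_mx n.
    by apply/matrixP => i j; rewrite mxE !rE dr.
  by rewrite IH e1 e0 ul mxE /= subr0 expr0 !mulr1 addr0.
by rewrite rE e0 ur mulr0 mul0r.
Qed.
End MatrixForm.

Section FgProjective.
Context {R : comPzRingType}.

Fact cV_fg_projective n : fg_projective 'cV[R]_n.
Proof.
split; first by exists n, idfun => v; exists v.
move=> M N g f g_surj.
have /choice[m mP] : forall k : 'I_n, exists x, g x = f (delta_mx k 0).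
  by move=> k; apply: g_surj.
have l : linear (fun v : 'cV[R]_n => \sum_k v k 0 *: m k).
  move=> c u v; rewrite scaler_sumr -big_split; apply: eq_bigr => k _ /=.
  by rewrite !mxE scalerDl scalerA.
exists (mk_linear l) => v /=.
rewrite [in RHS](matrix_sum_delta v) !linear_sum; apply: eq_bigr => k _.
by rewrite big_ord1 !linearZ /= mP.
Qed.

Fact regular_fg_projective : fg_projective R^o.
Proof.
split.
  have l : linear (fun v : 'cV[R]_1 => v 0 0 : R^o) by move=> c u v; rewrite !mxE.
  by exists 1, (mk_linear l) => r; exists (const_mx r); rewrite /= mxE.
move=> M N g f g_surj; have [x gx] := g_surj (f 1).
have l : linear (fun r : R^o => r *: x).
  by move=> c u v; rewrite scalerDl scalerA.
exists (mk_linear l) => r /=.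
by rewrite linearZ /= gx -[r in RHS]mulr1 -[r * 1]/(r *: (1 : R^o)) linearZ.
Qed.

Fact prod_fg_projective (P Q : lmodType R) :
  fg_projective P -> fg_projective Q -> fg_projective (P * Q)%type.
Proof.
move=> [[m [u u_surj]] Pproj] [[n [v v_surj]] Qproj]; split.
  have l : linear (fun w : 'cV[R]_(m + n) => (u (usubmx w), v (dsubmx w))).
    by move=> c x y; rewrite !linearP.
  exists (m + n)%N, (mk_linear l) => -[p q].
  have [x ux] := u_surj p; have [y vy] := v_surj q.
  by exists (col_mx x y); rewrite /= col_mxKu col_mxKd ux vy.
move=> M N g f g_surj.
have l1 : linear (fun p : P => f (p, 0)).
  by move=> c x y; rewrite -linearP (inl_is_linear Q c x y).
have l2 : linear (fun q : Q => f (0, q)).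
  move=> c x y; rewrite -linearP; congr (f _).
  by rewrite -[RHS]/(c *: 0 + 0, c *: x + y) scaler0 addr0.
have [h1 h1P] := Pproj M N g (mk_linear l1) g_surj.
have [h2 h2P] := Qproj M N g (mk_linear l2) g_surj.
have l : linear (fun w : (P * Q)%type => h1 w.1 + h2 w.2).
  by move=> c x y; rewrite !linearP scalerDr addrACA.
exists (mk_linear l) => -[p q]; rewrite /= linearD h1P h2P /= -linearD.
by congr (f _); rewrite -[LHS]/(p + 0, 0 + q) addr0 add0r.
Qed.
End FgProjective.

Record triple (R : comPzRingType) := Triple {
  tr_module : lmodType R;
  tr_fgp : fg_projective tr_module;
  tr_form0 : altform tr_module;
  tr_form1 : altform tr_module }.

Definition isometric {R : comPzRingType} (s t : triple R) : Prop :=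
  exists h : {linear tr_module s -> tr_module t},
    [/\ bijective h,
        forall p q, tr_form0 s p q = tr_form0 t (h p) (h q)
      & forall p q, tr_form1 s p q = tr_form1 t (h p) (h q)].

(* The first constructor makes the generators isometry classes. *)
Inductive VSL_rel (R : comPzRingType) :
    seq (int * triple R) -> seq (int * triple R) -> Prop :=
| VSL_isometric s t : isometric s t -> VSL_rel [:: (1, s)] [:: (1, t)]
| VSL_perp (P P' : lmodType R) (hP : fg_projective P) (hP' : fg_projective P')
    (g f : altform P) (g' f' : altform P') :
    VSL_rel
      [:: (1, Triple (prod_fg_projective hP hP') (perp g g') (perp f f'))]
      [:: (1, Triple hP g f); (1, Triple hP' g' f')]
| VSL_comp (P : lmodType R) (hP : fg_projective P) (f0 f1 f2 : altform P) :
    VSL_rel [:: (1, Triple hP f0 f1); (1, Triple hP f1 f2)]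
            [:: (1, Triple hP f0 f2)]
| VSL_SL (P : lmodType R) (hP : fg_projective P) (g f : altform P)
    (phi : SL P) :
    VSL_rel [:: (1, Triple hP g f)]
            [:: (1, Triple hP g (pullback (SL_bij phi) f))].

(* The underlying set of the group V_SL(R), as a set of congruence classes.   *)
(* A zmodType structure on it is ruled out by universe constraints, since it  *)
(* is a quotient of a type of triples containing arbitrary R-modules.         *)
Definition VSL (R : comPzRingType) : Type :=
  {C : seq (int * triple R) -> Prop | exists w, C = pres (@VSL_rel R) w}.

Definition VSL_pi {R : comPzRingType} (w : seq (int * triple R)) : VSL R :=
  exist _ (pres (@VSL_rel R) w) (ex_intro _ w erefl).

Lemma VSL_piP (R : comPzRingType) (w w' : seq (int * triple R)) :
  VSL_pi w = VSL_pi w' <-> pres (@VSL_rel R) w w'.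
Proof.
split=> [[/funeqP/(_ w') E]|ww'].
  by rewrite E; apply: pres_refl.
apply: eq_exist; apply/funext => u; apply/propext; split.
  exact/pres_trans/pres_sym.
exact: pres_trans.
Qed.

Definition VSL_class {R : comPzRingType} (t : triple R) : VSL R :=
  VSL_pi [:: (1, t)].

(* The image of the kernel W_SL(R) of the Pfaffian under                      *)
(* M |-> [R^2n, psi_2n, M].                                                   *)
Definition in_VSL_tilde {R : comPzRingType} (v : VSL R) : Prop :=
  exists (n : nat) (M : altmx n), pfaffian M = 1 /\
    v = VSL_class (Triple (cV_fg_projective n.*2) (mxform (psi n)) (mxform M)).

Definition VSL_tilde (R : comPzRingType) : Type :=
  {v : VSL R | in_VSL_tilde v}.

Section Psi2.
Context {R : comPzRingType}.

Definition psi2_fun (x y : (R^o * R^o)%type) : R := x.1 * y.2 - x.2 * y.1.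

Fact psi2_linearl y : scalar (psi2_fun^~ y).
Proof.
move=> c u v; rewrite /psi2_fun.
rewrite -[(c *: u + v).1]/(c * u.1 + v.1) -[(c *: u + v).2]/(c * u.2 + v.2).
ring.
Qed.

Fact psi2_linearr x : scalar (psi2_fun x).
Proof.
move=> c u v; rewrite /psi2_fun.
rewrite -[(c *: u + v).1]/(c * u.1 + v.1) -[(c *: u + v).2]/(c * u.2 + v.2).
ring.
Qed.

Fact psi2_alt x : psi2_fun x x = 0.
Proof. by rewrite /psi2_fun mulrC subrr. Qed.

Fact psi2_nondeg (g : {scalar (R^o * R^o)%type}) :
  exists! x, forall y, psi2_fun x y = g y.
Proof.
have gE y : g y = y.1 * g (1, 0) + y.2 * g (0, 1).
  have {1}-> : y = y.1 *: ((1, 0) : (R^o * R^o)%type)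
      + y.2 *: ((0, 1) : (R^o * R^o)%type).
    rewrite -[RHS]/(y.1 * 1 + y.2 * 0, y.1 * 0 + y.2 * 1).
    by rewrite !mulr1 !mulr0 addr0 add0r; case: y.
  by rewrite linearP linearZ.
exists (g (0, 1), - g (1, 0)); split=> [y|[x1 x2] hx].
  by rewrite [RHS]gE /psi2_fun /= mulNr opprK addrC mulrC [g (0, 1) * _]mulrC.
by rewrite -!hx /psi2_fun /= !(mulr0, mulr1, subr0, sub0r, opprK).
Qed.

Definition psi2 : altform (R^o * R^o)%type :=
  AltForm psi2_linearl psi2_linearr psi2_alt psi2_nondeg.
End Psi2.

Section Symbol.
Context {R : comPzRingType} (P0 : lmodType R).

Section WithSection.
Context (a : Um (P0 * R^o)%type) (s : {linear R^o -> (P0 * R^o)%type}).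
Context (aK : cancel s a).

Fact i_s_ker p : p - s (a p) \in ker_pred a.
Proof. by rewrite unfold_in linearB /= aK subrr. Qed.

Definition i_s (p : (P0 * R^o)%type) : (ker a * R^o)%type :=
  (Ker (i_s_ker p), a p).

(* i_s (+) 1, with the summand R^2 grouped as in the form chi_a _|_ psi_2 *)
Definition i_s1_fun (x : (P0 * (R^o * R^o))%type) : (ker a * (R^o * R^o))%type :=
  let: (p, (u, v)) := x in let: (k, w) := i_s (p, u) in (k, (w, v)).

Fact i_s1_is_linear : linear i_s1_fun.
Proof.
move=> c [p [u v]] [p' [u' v']].
set q := (p, u); set q' := (p', u').
have aE : a (c *: q + q') = c * a q + a q' by rewrite linearP.
have sE : s (c * a q + a q') = c *: s (a q) + s (a q') := linearP s c _ _.
have kE : Ker (i_s_ker (c *: q + q')) = c *: Ker (i_s_ker q) + Ker (i_s_ker q').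
  apply: val_inj; rewrite -[RHS]/(ker_val _) ker_val_is_linear /=.
  by rewrite aE sE scalerBr opprD addrACA.
rewrite -[LHS]/(Ker (i_s_ker (c *: q + q')), (a (c *: q + q'), c * v + v')).
by rewrite kE aE.
Qed.

Definition i_s1 := mk_linear i_s1_is_linear.

Fact i_s1_bij : bijective i_s1.
Proof.
exists (fun y : (ker a * (R^o * R^o))%type =>
  let p := ker_val y.1 + s y.2.1 in (p.1, (p.2, y.2.2))).
  move=> [p [u v]]; set q : (P0 * R^o)%type := (p, u).
  rewrite -[LHS]/(let z := q - s (a q) + s (a q) in (z.1, (z.2, v))).
  by rewrite subrK.
move=> [k [w v]]; have ak : a (ker_val k) = 0 by exact/eqP/ker_valP.
set y := ker_val k + s w.
have aE : a y = w by rewrite linearD /= ak aK add0r.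
rewrite -[LHS]/(let z := (y.1, y.2) in (Ker (i_s_ker z), (a z, v))).
have kE : Ker (i_s_ker y) = k by apply: val_inj; rewrite /= aE addrK.
by rewrite -surjective_pairing /= kE aE.
Qed.
End WithSection.

Context (hP0 : fg_projective P0) (theta0 : {linear R^o -> ext 2 P0}).

(* [is_vaserstein a v] says that v is the value V(a): there are a section s   *)
(* of a, the induced trivialization theta of det P(a), and the forms chi_0,   *)
(* chi_a attached to theta0, theta, such that v is the class of               *)
(* [P0 (+) R^2, chi_0 _|_ psi_2, (i_s (+) 1)^t (chi_a _|_ psi_2) (i_s (+) 1)].*)
(* The equation on theta says that det P0 and det P(a) are identified through *)
(* x /\ y |-> x /\ y /\ (0, 1) and p /\ q |-> p /\ q /\ s(1).                 *)
Definition is_vaserstein (a : Um (P0 * R^o)%type) (v : VSL_tilde R) : Prop :=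
  exists (s : {linear R^o -> (P0 * R^o)%type}) (aK : cancel s a)
      (theta : {linear R^o -> ext 2 (ker a)})
      (chi0 : altform P0) (chi : altform (ker a)),
    [/\ bijective theta,
        forall r : R^o, wedge_with 2 (ker_incl a) (s 1) (theta r) =
          wedge_with 2 (inl_lin P0 R^o) (0, 1) (theta0 r),
        forall p q, theta0 (chi0 p q) = wedge2 p q,
        forall p q, theta (chi p q) = wedge2 p q
      & sval v = VSL_class (Triple
          (prod_fg_projective hP0
             (prod_fg_projective regular_fg_projective regular_fg_projective))
          (perp chi0 psi2) (pullback (i_s1_bij aK) (perp chi psi2)))].
End Symbol.

(* Main.v *)
Require Import Defs.
From HB Require Import structures.
From mathcomp Require Import all_boot all_order all_algebra fingroup perm.
From mathcomp Require Import ring zify boolp.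

Set Implicit Arguments.
Unset Strict Implicit.
Unset Printing Implicit Defensive.

Import GRing.Theory.
Local Open Scope ring_scope.

(** The area form chi(p, q) = theta0^-1(p /\ q) on P0 satisfies the relation
    chi(p, q) w + chi(q, w) p + chi(w, p) q = 0 of a module of rank two, and
    the formula vol = r1 chi(p2, p3) + r2 chi(p3, p1) + r3 chi(p1, p2) makes
    it into a volume form on N = P0 (+) R.  If e = s(1) is the value of the
    chosen section, then the form chi_a on ker a is vol(., ., e), and the form
    V(a, s) on N (+) R becomes

      V(a, e) ((x, u), (y, v)) = vol(x, y, e) + a(x) v - u a(y),

    which mentions neither ker a nor its determinant any more
    ([pullback_symbol_form], [kernel_area_unique]).

    Invariance.  An element phi of SL(N) preserves vol ([vol_SL]), so that
    V(a phi, phi^-1 e) is the pullback of V(a, e) along phi (+) 1.  Replacing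
    e by another e' with a(e') = 1 amounts to a transvection
    (x, u) |-> (x, u + l(x)) with l = vol(e, ., e' - e).  Both maps lie in
    SL(P0 (+) R^2) and relation (3) of V_SL identifies a form with its
    pullback along such maps.  One lemma, [symbol_SL_invariant], does both at
    once: it gives the independence of the section for phi = 1, and the
    theorem in general.

    Membership in the kernel of the Pfaffian.  Writing
    1 = sum_j c_j chi(x_j, y_j) gives an isometric embedding of (P0, chi) into
    a standard symplectic module R^2n, with an orthogonal complement (Q, g).
    Adding the null triple (Q, g, g) turns (P0 (+) R^2, chi _|_ psi_2, V(a, e))
    into (R^(2n+2), psi, M) for an explicit M, and pf(M) = 1 has to be shown.
    Here the Pfaffian obeys pf(E^t M E) = det(E) pf(M) ([pfaffian_pull]),
    because pf of a Gram matrix is an alternating multilinear function of the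
    vectors.

    Working locally without localizing.  The facts that concern P0 hold after
    inverting an area h = chi(x, y), where P0 becomes free on x, y.  Instead
    of a localization the maps v |-> v_0 x + v_1 y from R^2 to P0 and
    p |-> (chi(p, y), chi(x, p)) back are used: both composites are
    multiplication by h.  This yields each identity up to a power of h, and
    since finitely many such h generate the unit ideal, an element killed by
    a power of every area vanishes ([area_local]). *)

(** * Alternating maps and exterior powers *)

Record alt2 {R : comPzRingType} {P X : lmodType R} (f : P -> P -> X) : Prop :=
  Alt2 {
    alt2_lin : forall y, linear (f^~ y);
    alt2_swap : forall x y, f y x = - f x y;
    alt2_xx : forall x, f x x = 0 }.

(** Cyclic symmetry replaces linearity in the second and third argument: for
    the cyclic sums met below it holds by commutativity of addition. *)
Record alt3 {R : comPzRingType} {P X : lmodType R} (f : P -> P -> P -> X) :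
    Prop := Alt3 {
  alt3_lin : forall y z, linear (fun x => f x y z);
  alt3_cyc : forall x y z, f x y z = f y z x;
  alt3_xx : forall x z, f x x z = 0 }.

Section Alternating.
Context {R : comPzRingType} {P X : lmodType R}.

Lemma alt2_linr (f : P -> P -> X) : alt2 f -> forall x, linear (f x).
Proof.
move=> [fl fs _] x c y z.
by rewrite fs fl [f y x]fs [f z x]fs scalerN -opprD opprK.
Qed.

Lemma alt3_swap (f : P -> P -> P -> X) :
  alt3 f -> forall x y z, f y x z = - f x y z.
Proof.
move=> [fl fc f0] x y z; apply/eqP; rewrite -addr_eq0; apply/eqP.
have fD u v w t : f (u + v) w t = f u w t + f v w t.
  by rewrite -[u]scale1r fl !scale1r.
have fD2 u v w t : f t (u + v) w = f t u w + f t v w.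
  by rewrite fc fD -!(fc t).
by have := f0 (x + y) z; rewrite fD !fD2 !f0 add0r addr0 addrC.
Qed.

Lemma alt3_fst (f : P -> P -> P -> X) : alt3 f -> forall z, alt2 (fun x y => f x
  y z).
Proof.
by move=> fA z; split=> [y|x y|x]; [apply: alt3_lin|apply: alt3_swap|apply:
  alt3_xx].
Qed.

Lemma alt3_linr (f : P -> P -> P -> X) :
  alt3 f -> forall x y, linear (f x y).
Proof. by move=> [fl fc _] x y c z t; rewrite -!(fc _ x y) fl. Qed.

Lemma alt3D (f : P -> P -> P -> X) : alt3 f ->
  forall x x' y y' z z', f (x + x') (y + y') (z + z') =
    f x y z + f x y z' + (f x y' z + f x y' z')
      + (f x' y z + f x' y z' + (f x' y' z + f x' y' z')).
Proof.
move=> [fl fc _] x x' y y' z z'.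
have fD u v w t : f (u + v) w t = f u w t + f v w t.
  by rewrite -[u]scale1r fl !scale1r.
have fD2 u v w t : f t (u + v) w = f t u w + f t v w.
  by rewrite fc fD -!(fc t).
have fD3 u v w t : f t w (u + v) = f t w u + f t w v.
  by rewrite -!(fc _ t w) fD.
by rewrite fD !fD2 !fD3.
Qed.
End Alternating.

Lemma ord2E (i : 'I_2) : i = ord0 \/ i = ord_max.
Proof. by case: i => -[|[|//]] ?; [left|right]; apply: val_inj. Qed.

Lemma ord3E (i : 'I_3) : [\/ i = ord0, i = inord 1 | i = ord_max].
Proof.
by case: i => -[|[|[|//]]] ?; [constructor 1|constructor 2|constructor 3];
  apply: val_inj; rewrite /= ?inordK.
Qed.

Definition wedge3 {R : comPzRingType} {M : lmodType R} (x y z : M) : ext 3 M :=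
  wedge [ffun i : 'I_3 => [:: x; y; z]`_i].

Section ExteriorSquare.
Context {R : comPzRingType} {M : lmodType R}.

Lemma wedge_2E (m : {ffun 'I_2 -> M}) : wedge m = wedge2 (m ord0) (m ord_max).
Proof. by congr wedge; apply/ffunP => i; rewrite !ffunE; case: (ord2E i) => ->.
  Qed.

Lemma wedge_3E (m : {ffun 'I_3 -> M}) :
  wedge m = wedge3 (m ord0) (m (inord 1)) (m ord_max).
Proof.
congr wedge; apply/ffunP => i; rewrite !ffunE.
by case: (ord3E i) => -> //=; rewrite inordK.
Qed.

Lemma wedge2_alt2 : alt2 (@wedge2 R M).
Proof.
have l y : linear (fun x : M => wedge2 x y).
  move=> c x x'; pose m := [ffun i : 'I_2 => [:: x; y]`_i].
  have := @wedge_multilinear _ _ _ m ord0 c x x'.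
  by rewrite !wedge_2E !ffunE.
have lr x : linear (fun y : M => wedge2 x y).
  move=> c y y'; pose m := [ffun i : 'I_2 => [:: x; y]`_i].
  have := @wedge_multilinear _ _ _ m ord_max c y y'.
  by rewrite !wedge_2E !ffunE.
have xx x : wedge2 x x = 0 :> ext 2 M.
  pose m := [ffun i : 'I_2 => [:: x; x]`_i].
  by apply: (@wedge_alternating _ _ _ m ord0 ord_max); rewrite // !ffunE.
have D x y z : wedge2 (x + y) z = wedge2 x z + wedge2 y z :> ext 2 M.
  by rewrite -[x]scale1r l !scale1r.
have Dr x y z : wedge2 z (x + y) = wedge2 z x + wedge2 z y :> ext 2 M.
  by rewrite -[x]scale1r lr !scale1r.
split=> // x y; apply/eqP; rewrite -addr_eq0; apply/eqP.
by have := xx (x + y); rewrite D !Dr !xx add0r addr0 addrC.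
Qed.

Lemma wedge3_alt3 : alt3 (@wedge3 R M).
Proof.
have l1 y z : linear (fun x : M => wedge3 x y z).
  move=> c x x'; pose m := [ffun i : 'I_3 => [:: x; y; z]`_i].
  have := @wedge_multilinear _ _ _ m ord0 c x x'.
  by rewrite !wedge_3E !ffunE -!val_eqE /= !inordK.
have l2 x z : linear (fun y : M => wedge3 x y z).
  move=> c y y'; pose m := [ffun i : 'I_3 => [:: x; y; z]`_i].
  have := @wedge_multilinear _ _ _ m (inord 1) c y y'.
  by rewrite !wedge_3E !ffunE -!val_eqE /= !inordK.
have l3 x y : linear (fun z : M => wedge3 x y z).
  move=> c z z'; pose m := [ffun i : 'I_3 => [:: x; y; z]`_i].
  have := @wedge_multilinear _ _ _ m ord_max c z z'.
  by rewrite !wedge_3E !ffunE -!val_eqE /= !inordK.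
have x12 x z : wedge3 x x z = 0 :> ext 3 M.
  pose m := [ffun i : 'I_3 => [:: x; x; z]`_i].
  by apply: (@wedge_alternating _ _ _ m ord0 (inord 1));
    rewrite ?ffunE -?val_eqE /= inordK.
have x23 x y : wedge3 x y y = 0 :> ext 3 M.
  pose m := [ffun i : 'I_3 => [:: x; y; y]`_i].
  by apply: (@wedge_alternating _ _ _ m (inord 1) ord_max);
    rewrite ?ffunE -?val_eqE /= inordK.
have D1 x y z t : wedge3 (x + y) z t = wedge3 x z t + wedge3 y z t :> ext 3 M.
  by rewrite -[x]scale1r l1 !scale1r.
have D2 x y z t : wedge3 z (x + y) t = wedge3 z x t + wedge3 z y t :> ext 3 M.
  by rewrite -[x]scale1r l2 !scale1r.
have D3 x y z t : wedge3 z t (x + y) = wedge3 z t x + wedge3 z t y :> ext 3 M.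
  by rewrite -[x]scale1r l3 !scale1r.
split=> // x y z; transitivity (- wedge3 y x z).
  apply/eqP; rewrite -addr_eq0; apply/eqP.
  by have := x12 (x + y) z; rewrite D1 !D2 !x12 add0r addr0.
apply/eqP; rewrite eqr_oppLR -addr_eq0; apply/eqP.
by have := x23 y (x + z); rewrite D2 !D3 !x23 add0r addr0.
Qed.

Lemma ext2_lift (X : lmodType R) (f : M -> M -> X) : alt2 f ->
  exists L : {linear ext 2 M -> X}, forall x y, L (wedge2 x y) = f x y.
Proof.
move=> fA; have fl := alt2_lin fA; have fr := alt2_linr fA.
have ml : multilinear_map (fun m : {ffun 'I_2 -> M} => f (m ord0) (m ord_max)).
  by move=> m i c x y; rewrite !ffunE; case: (ord2E i) => -> /=; rewrite ?fl
    ?fr.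
have al : alternating_map (fun m : {ffun 'I_2 -> M} => f (m ord0) (m ord_max)).
  move=> m i j; case: (ord2E i) => ->; case: (ord2E j) => -> // _ mE.
    by rewrite mE (alt2_xx fA).
  by rewrite mE (alt2_xx fA).
by exists (ext_lift ml al) => x y; rewrite ext_lift_wedge !ffunE.
Qed.

Lemma ext3_lift (X : lmodType R) (f : M -> M -> M -> X) : alt3 f ->
  exists L : {linear ext 3 M -> X}, forall x y z, L (wedge3 x y z) = f x y z.
Proof.
move=> fA; have fl := alt3_lin fA; have fr := alt3_linr fA.
have fc := alt3_cyc fA; have f0 := alt3_xx fA.
pose F (m : {ffun 'I_3 -> M}) := f (m ord0) (m (inord 1)) (m ord_max).
have ml : multilinear_map F.
  move=> m i c x y; rewrite /F !ffunE.
  case: (ord3E i) => -> /=; rewrite -!val_eqE /= !inordK //= ?fl ?fr //.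
  by rewrite fc fl -!(fc (m ord0)).
have al : alternating_map F.
  move=> m i j; rewrite /F.
  case: (ord3E i) => ->; case: (ord3E j) => ->; rewrite -?val_eqE /= ?inordK //=
    => _ mE.
  - by rewrite mE f0.
  - by rewrite mE -fc f0.
  - by rewrite mE f0.
  - by rewrite mE fc f0.
  - by rewrite mE -fc f0.
  - by rewrite mE fc f0.
by exists (ext_lift ml al) => x y z; rewrite ext_lift_wedge /F !ffunE /= inordK.
Qed.

Lemma ext2_eq (X : lmodType R) (L L' : {linear ext 2 M -> X}) :
  (forall x y, L (wedge2 x y) = L' (wedge2 x y)) -> forall u, L u = L' u.
Proof.
move=> LL' u; apply: (@ext_ind _ _ _ (fun u => L u = L' u)) => [c m v IH|].
  by rewrite !linearP IH wedge_2E LL'.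
by rewrite !linear0.
Qed.

End ExteriorSquare.

Lemma wedge_with_wedge2 (R : comPzRingType) (M N : lmodType R)
    (g : {linear M -> N}) n x y :
  wedge_with 2 g n (wedge2 x y) = wedge3 (g x) (g y) n.
Proof.
rewrite /wedge_with ext_lift_wedge /= wedge_3E; congr wedge3; rewrite !ffunE.
- have -> : ord0 = lift ord_max ord0 :> 'I_3 by apply: val_inj.
  by rewrite liftK ffunE.
- have -> : inord 1 = lift ord_max ord_max :> 'I_3.
    by apply: val_inj; rewrite /= inordK.
  by rewrite liftK ffunE.
- by rewrite unlift_none.
Qed.

(** * Modules with a trivial exterior square *)

(** What a trivialization of the exterior square leaves to work with: every
    alternating bilinear map is a multiple of chi, and the values of chi
    generate the unit ideal.  The trivialization itself can then be forgotten,
    and so can local bases. *)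
Record area_form {R : comPzRingType} {P : lmodType R} (chi : P -> P -> R) :
    Prop := AreaForm {
  area_alt2 : alt2 (chi : P -> P -> R^o);
  area_univ : forall (X : lmodType R) (f : P -> P -> X), alt2 f ->
    exists K, forall p q, f p q = chi p q *: K;
  area_unit : exists s : seq (R * (P * P)),
    \sum_(t <- s) t.1 * chi t.2.1 t.2.2 = 1 }.

(** In each term of the binomial expansion one of the two exponents is large
    enough to kill z. *)
Lemma scaler_expD_eq0 (R : comPzRingType) (X : lmodType R) (a b : R) (z : X)
    m k :
  a ^+ m *: z = 0 -> b ^+ k *: z = 0 -> (a + b) ^+ (m + k) *: z = 0.
Proof.
move=> az bz; rewrite exprDn scaler_suml big1 // => -[i /= lti] _.
case: (leqP k i) => ki.
  rewrite -(subnK ki) exprD mulrA -mulrnAl -scalerA.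
  by rewrite bz scaler0.
have mi : (m <= m + k - i)%N by rewrite -addnBA ?(ltnW ki) // leq_addr.
rewrite -(subnK mi) exprD -mulrnAr -mulrA [a ^+ m * _]mulrC mulrA -scalerA.
by rewrite az scaler0.
Qed.

Section AreaForm.
Context {R : comPzRingType} {P : lmodType R} (chi : P -> P -> R).
Hypothesis chiA : area_form chi.

Let chi_alt : alt2 (chi : P -> P -> R^o) := area_alt2 chiA.

Lemma areaC x y : chi y x = - chi x y. Proof. exact: (alt2_swap chi_alt). Qed.
Lemma area_xx x : chi x x = 0. Proof. exact: (alt2_xx chi_alt). Qed.
Lemma areaPl y : scalar (chi^~ y). Proof. exact: (alt2_lin chi_alt). Qed.
Lemma areaPr x : scalar (chi x). Proof. exact: (alt2_linr chi_alt). Qed.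

Lemma areaDl x x' y : chi (x + x') y = chi x y + chi x' y.
Proof. by rewrite -[x]scale1r areaPl mul1r scale1r. Qed.
Lemma areaDr x y y' : chi x (y + y') = chi x y + chi x y'.
Proof. by rewrite -[y]scale1r areaPr mul1r scale1r. Qed.
Lemma areaZl c x y : chi (c *: x) y = c * chi x y.
Proof. exact: (linearZ_LR (mk_scalar (areaPl y))). Qed.
Lemma areaZr c x y : chi x (c *: y) = c * chi x y.
Proof. exact: (linearZ_LR (mk_scalar (areaPr x))). Qed.

(** The elements of R with a power killing z form an ideal; if it contains
    all areas then it contains 1.  This lemma stands for the localizations of
    R in which P is free on two elements x, y. *)
Lemma area_local (X : lmodType R) (z : X) :
  (forall x y, exists k, chi x y ^+ k *: z = 0) -> z = 0.
Proof.
move=> chiz; have [s s1] := area_unit chiA.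
suff [k] : exists k, (\sum_(t <- s) t.1 * chi t.2.1 t.2.2) ^+ k *: z = 0.
  by rewrite s1 expr1n scale1r.
elim: s {s1} => [|[c [x y]] s [k IH]].
  by exists 1%N; rewrite big_nil expr1 scale0r.
have [m xyz] := chiz x y; exists (m + k)%N; rewrite big_cons.
by apply: scaler_expD_eq0 => //=; rewrite exprMn -scalerA xyz scaler0.
Qed.

Lemma area_span (X : lmodType R) (z : X) :
  (forall x y, chi x y *: z = 0) -> z = 0.
Proof. by move=> chiz; apply: area_local => x y; exists 1%N; rewrite expr1. Qed.

(** Since F(., ., w) is a multiple of chi, the vectors u, v in
    chi(p, q) F(u, v, w) may be exchanged with p, q.  Doing this twice turns
    chi(p, q)^2 F(x, y, z) into a multiple of some F with a repeated argument.
    This is the vanishing of the third exterior power of P. *)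
Lemma area_alt3_eq0 (X : lmodType R) (F : P -> P -> P -> X) :
  alt3 F -> forall x y z, F x y z = 0.
Proof.
move=> FA x y z; apply: area_local => p q; exists 2%N.
have F0 u v w : chi p q *: F u v w = chi u v *: F p q w.
  have [K FE] := area_univ chiA (alt3_fst FA w).
  by rewrite !FE !scalerA mulrC.
rewrite expr2 -scalerA F0 scalerA mulrC -scalerA (alt3_cyc FA) F0.
by rewrite -(alt3_cyc FA) (alt3_xx FA) !scaler0.
Qed.

(** As a function of p, q, w the left side is alternating and trilinear. *)
Lemma area_plucker p q w :
  chi p q *: w + chi q w *: p + chi w p *: q = 0.
Proof.
pose F p q w := chi p q *: w + chi q w *: p + chi w p *: q.
apply: (@area_alt3_eq0 _ F); split=> [y z c u v|x y z|x z]; rewrite /F.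
- rewrite areaPl areaPr !scalerDl !scalerDr !scalerA [c * chi y z]mulrC.
  by rewrite [X in X + _ = _]addrACA [LHS]addrACA.
- by rewrite -addrA addrC.
by rewrite area_xx scale0r add0r -scalerDl areaC addNr scale0r.
Qed.

Lemma area_plucker_scalar (a : {scalar P}) p q w :
  chi p q * a w + chi q w * a p + chi w p * a q = 0.
Proof. by have := congr1 a (area_plucker p q w); rewrite !linearD !linearZ
  linear0. Qed.

(** A functional g is represented by
    sum_j c_j (g(y_j) x_j - g(x_j) y_j), where sum_j c_j chi(x_j, y_j) = 1:
    apply g to the three-term relation for x_j, y_j, q. *)
Lemma area_nondeg (g : {scalar P}) : exists! p, forall q, chi p q = g q.
Proof.
have [s s1] := area_unit chiA.
pose f (t : R * (P * P)) := t.1 *: (g t.2.2 *: t.2.1 - g t.2.1 *: t.2.2).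
pose p0 := \sum_(t <- s) f t.
have p0P q : chi p0 q = g q.
  rewrite -[LHS]/(mk_scalar (areaPl q) p0) -[RHS]mul1r -s1 mulr_suml linear_sum.
  apply: eq_bigr => -[c [x y]] _.
  rewrite linearZ -mulrA linearB !linearZ /=; congr (_ * _).
  have := area_plucker_scalar g x y q; rewrite (areaC x q) => E.
  by apply/eqP; rewrite -subr_eq0 -oppr_eq0 -[X in _ == X]E; apply/eqP; ring.
exists p0; split=> // p hp; apply/eqP; rewrite -subr_eq0; apply/eqP.
apply: area_span => x y; have z0 q : chi (p0 - p) q = 0.
  by rewrite -[LHS]/(mk_scalar (areaPl q) _) linearB /= p0P hp subrr.
have := area_plucker x y (p0 - p).
by rewrite (areaC _ y) !z0 oppr0 !scale0r !addr0.
Qed.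

Lemma area_altform : exists f : altform P, forall p q, f p q = chi p q.
Proof. by exists (AltForm areaPl areaPr area_xx area_nondeg). Qed.
End AreaForm.

Lemma det_trivialization_area (R : comPzRingType) (P : lmodType R)
    (theta : {linear R^o -> ext 2 P}) :
  bijective theta ->
  exists chi : P -> P -> R,
    (forall p q, theta (chi p q) = wedge2 p q) /\ area_form chi.
Proof.
move=> [T thetaK TK]; have Tlin : linear T.
  by move=> c u v; apply: (can_inj thetaK); rewrite linearP !TK.
pose Tl := mk_linear Tlin; exists (fun p q => T (wedge2 p q)).
split=> [p q|]; first by rewrite TK.
have [wl ws w0] := @wedge2_alt2 R P; split.
- split=> [y c x x'|x y|x]; first by rewrite wl Tlin.
    by rewrite ws -[LHS]/(Tl _) linearN.
  by rewrite w0; apply: (linear0 Tl).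
- move=> X f fA; have [L LE] := ext2_lift fA; exists (L (theta 1)) => p q.
  have e1 : T (wedge2 p q) = T (wedge2 p q) *: (1 : R^o) by rewrite -[RHS]/(_ *
    1) mulr1.
  by rewrite -LE -linearZ -linearZ -e1 TK.
- suff [s sE] : exists s : seq (R * (P * P)),
      \sum_(t <- s) t.1 * T (wedge2 t.2.1 t.2.2) = T (theta 1).
    by exists s; rewrite sE thetaK.
  apply: (@ext_ind _ _ _ (fun u => exists s, _ = T u)) => [c m u [s IH]|].
    exists ((c, (m ord0, m ord_max)) :: s).
    by rewrite big_cons IH Tlin wedge_2E.
  by exists [::]; rewrite big_nil; apply/esym/(linear0 Tl).
Qed.

(** * The volume form on P (+) R *)

(** This is the form with vol(p, q, (0, 1)) = chi(p, q), the coordinate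
    expression of x /\ y /\ z in the determinant of P (+) R. *)
Definition vol {R : comPzRingType} {P : lmodType R} (chi : P -> P -> R)
    (x y z : (P * R^o)%type) : R :=
  x.2 * chi y.1 z.1 + y.2 * chi z.1 x.1 + z.2 * chi x.1 y.1.

Section Volume.
Context {R : comPzRingType} {P : lmodType R} (chi : P -> P -> R).
Hypothesis chiA : area_form chi.
Local Notation N := (P * R^o)%type.
Local Notation vol := (vol chi).

Lemma vol_alt3 : alt3 (vol : N -> N -> N -> R^o).
Proof.
have C := areaC chiA; have l := areaPl chiA; have lr := areaPr chiA.
split=> [y z c u v|x y z|x z]; rewrite /vol.
- rewrite -[(c *: u + v).1]/(c *: u.1 + v.1) -[(c *: u + v).2]/(c * u.2 + v.2).
  by rewrite l lr -[c *: _]/(c * _); ring.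
- by ring.
- by rewrite (area_xx chiA) [chi z.1 _]C; ring.
Qed.

Let top : N := (0, 1).

Lemma vol_top x y : vol (x, 0) (y, 0) top = chi x y.
Proof. by rewrite /vol !mul0r !add0r mul1r. Qed.

Lemma prod_split (u : N) : u = (u.1, 0) + u.2 *: top.
Proof.
case: u => u r; rewrite -[RHS]/(u + r *: 0, 0 + r * 1).
by rewrite scaler0 addr0 add0r mulr1.
Qed.

(** Expand each argument along P (+) R: the term with three arguments in P
    vanishes by [area_alt3_eq0], the terms with a repeated (0, 1) vanish as
    well, and G(x, y, (0, 1)) is a multiple of chi. *)
Lemma vol_univ (X : lmodType R) (G : N -> N -> N -> X) : alt3 G ->
  exists K, forall x y z, G x y z = vol x y z *: K.
Proof.
move=> GA; have [Gl Gc G0] := GA.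
have GZ c x y z : G (c *: x) y z = c *: G x y z.
  have Gl0 : G 0 y z = 0.
    by have := Gl y z (-1) 0 0; rewrite scaler0 addr0 scaleN1r addNr.
  by rewrite -[c *: x]addr0 Gl Gl0 addr0.
have GZ2 c x y z : G x (c *: y) z = c *: G x y z by rewrite Gc GZ -!(Gc x).
have GZ3 c x y z : G x y (c *: z) = c *: G x y z by rewrite -Gc GZ Gc.
have GP (x y z : P) : G (x, 0) (y, 0) (z, 0) = 0.
  pose F x y z := G (x, 0) (y, 0) (z, 0).
  apply: (@area_alt3_eq0 _ _ _ chiA _ F); split=> [v w c u u'|u v w|u w];
    rewrite /F.
  - by rewrite -Gl (inl_is_linear R^o).
  - exact: Gc.
  - exact: G0.
have [K GK] : exists K, forall x y : P, G (x, 0) (y, 0) top = chi x y *: K.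
  apply: (area_univ chiA (f := fun x y => G (x, 0) (y, 0) top)).
  split=> [v c u u'|u v|u].
  - by rewrite -Gl (inl_is_linear R^o).
  - exact: (alt3_swap GA).
  - exact: G0.
have GK2 x y : G (x, 0) top (y, 0) = chi y x *: K by rewrite Gc -GK Gc -Gc.
have GK3 x y : G top (x, 0) (y, 0) = chi x y *: K by rewrite Gc GK.
have Gtt u : G u top top = 0 by rewrite Gc G0.
have Gtt2 u : G top u top = 0 by rewrite Gc Gc G0.
exists K => x y z; rewrite {1}[x]prod_split {1}[y]prod_split {1}[z]prod_split.
rewrite (alt3D GA) !(GZ, GZ2, GZ3) GP GK GK2 GK3 Gtt Gtt2 !G0 !scaler0 !addr0
  add0r.
by rewrite !scalerA -!scalerDl /vol addrC [X in _ + X]addrC addrA.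
Qed.

Lemma vol_span (X : lmodType R) (t : X) :
  (forall x y z, vol x y z *: t = 0) -> t = 0.
Proof. by move=> vt; apply: (area_span chiA) => x y; rewrite -vol_top. Qed.

(** Four vectors of a module of rank three are dependent; the relation
    between them is evaluated at a.  In coordinates it is a combination of four
    instances of the three-term relation for chi. *)
Lemma vol_exchange (a : {scalar N}) w x y z :
  a w * vol x y z = a x * vol w y z + a y * vol x w z + a z * vol x y w.
Proof.
have al : scalar (fun p : P => a (p, 0)).
  by move=> c u v; rewrite -linearP (inl_is_linear R^o).
have aE u : a u = a (u.1, 0) + u.2 * a top.
  by rewrite {1}[u]prod_split linearD linearZ.
have C := areaC chiA; have pl := area_plucker_scalar chiA (mk_scalar al).
rewrite /= in pl; rewrite (aE w) (aE x) (aE y) (aE z) /vol.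
pose B x y z := chi x y * a (z, 0) + chi y z * a (x, 0) + chi z x * a (y, 0).
have B0 : x.2 * B w.1 y.1 z.1 + y.2 * B x.1 w.1 z.1 + z.2 * B x.1 y.1 w.1
    - w.2 * B x.1 y.1 z.1 = 0.
  by rewrite /B !pl !mulr0 !addr0 subr0.
apply/eqP; rewrite -subr_eq0 -[X in _ == X]B0 /B.
rewrite (C w.1 x.1) (C w.1 y.1) (C w.1 z.1).
apply/eqP.
move: w.2 x.2 y.2 z.2 (a top); rewrite /GRing.regular => rw rx ry rz a1.
ring.
Qed.
End Volume.

(** * The kernel of a unimodular functional and the symbol form *)

Lemma regular_scale1 (R : comPzRingType) (r : R) : r *: (1 : R^o) = r.
Proof. exact: mulr1. Qed.

Section KernelArea.
Context {R : comPzRingType} {P : lmodType R} (chi : P -> P -> R).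
Hypothesis chiA : area_form chi.
Local Notation N := (P * R^o)%type.
Context (a : {scalar N}) (e : N) (ae : a e = 1).

Fact ker_proj_subproof x : x - a x *: e \in ker_pred a.
Proof. by rewrite unfold_in linearB linearZ /= ae mulr1 subrr. Qed.

Definition ker_proj_fun x : ker a := Ker (ker_proj_subproof x).

Fact ker_proj_is_linear : linear ker_proj_fun.
Proof.
move=> c u v; apply: val_inj; rewrite -[RHS]/(ker_val _) ker_val_is_linear /=.
by rewrite linearP scalerBr scalerDl scalerA opprD addrACA.
Qed.

(** The projection N -> ker a along e. *)
Definition ker_proj : {linear N -> ker a} := mk_linear ker_proj_is_linear.

Lemma ker_projK (p : ker a) : ker_proj (ker_val p) = p.
Proof.
apply: val_inj; have /eqP ap := ker_valP p.
by rewrite /= ap scale0r subr0.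
Qed.

(** Multiples of e do not change a volume with last argument e. *)
Lemma vol_proj x y : vol chi (x - a x *: e) (y - a y *: e) e = vol chi x y e.
Proof.
have vA := vol_alt3 chiA; have [vl vc v0] := vA.
have v0' u : vol chi u e e = 0 by rewrite vc v0.
have v1 z : vol chi (x - a x *: e) z e = vol chi x z e - a x * vol chi e z e.
  by rewrite addrC -scaleNr vl addrC -mulNr.
have v2 z : vol chi z (y - a y *: e) e = vol chi z y e - a y * vol chi z e e.
  by rewrite !(vc z) addrC -scaleNr vl addrC -mulNr.
have v0'' u : vol chi e u e = 0 by rewrite vc v0'.
by rewrite v1 !v2 !v0' !v0'' !mulr0 !subr0 mulr0 subr0.
Qed.

Lemma vol_section x y z :
  a z * vol chi x y e + a x * vol chi y z e + a y * vol chi z x e = vol chi x y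
    z.
Proof.
have vA := vol_alt3 chiA; have vc := alt3_cyc vA.
rewrite -[RHS]mul1r -ae (vol_exchange chiA a e x y z) (vc e y) -(vc z x e).
by rewrite -addrA addrC.
Qed.

(** The alternating map
    G(x, y, z) = a(z) x /\ y + a(x) y /\ z + a(y) z /\ x, projected to ker a,
    is the contraction of x /\ y /\ z by a.  It equals vol(x, y, z) kappa for
    one element kappa, and theta(r) = r kappa is the trivialization: for p, q
    in ker a the value G(p, q, e) is p /\ q, and vol(., ., e) is an inverse on
    generators. *)
Lemma kernel_trivialization :
  exists theta : {linear R^o -> ext 2 (ker a)},
    [/\ bijective theta,
        forall p q, theta (vol chi (ker_val p) (ker_val q) e) = wedge2 p q
      & forall theta0 : {linear R^o -> ext 2 P},
          (forall p q, theta0 (chi p q) = wedge2 p q) ->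
          forall r : R^o, wedge_with 2 (ker_incl a) e (theta r) =
            wedge_with 2 (inl_lin P R^o) (0, 1) (theta0 r)].
Proof.
have vA := vol_alt3 chiA; have [vl vc v0] := vA.
have [wl ws w0] := @wedge2_alt2 R (ker a).
pose G x y z : ext 2 (ker a) := a z *: wedge2 (ker_proj x) (ker_proj y)
  + a x *: wedge2 (ker_proj y) (ker_proj z)
  + a y *: wedge2 (ker_proj z) (ker_proj x).
have wr := alt2_linr (@wedge2_alt2 R (ker a)).
have GA : alt3 G.
  split=> [y z c u v|x y z|x z]; rewrite /G.
  - rewrite !linearP wl wr !scalerDl !scalerDr !scalerA.
    rewrite [a z * c]mulrC [a y * c]mulrC.
    by rewrite [X in X + _ = _]addrACA [LHS]addrACA.
  - by rewrite -addrA addrC.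
  - by rewrite w0 scaler0 add0r [wedge2 (ker_proj z) _]ws scalerN addrN.
have [kappa GE] := vol_univ chiA GA.
have thl : linear (fun r : R^o => r *: kappa).
  by move=> c u v; rewrite scalerDl scalerA.
pose theta := mk_linear thl.
have thE (p q : ker a) :
    theta (vol chi (ker_val p) (ker_val q) e) = wedge2 p q.
  have /eqP ap := ker_valP p; have /eqP aq := ker_valP q.
  by rewrite /= -GE /G ae ap aq scale1r !scale0r !addr0 !ker_projK.
have [L LE] : exists L : {linear ext 2 (ker a) -> R^o},
    forall p q, L (wedge2 p q) = vol chi (ker_val p) (ker_val q) e.
  apply: (@ext2_lift _ _ R^o (fun p q => vol chi (ker_val p) (ker_val q) e)).
  split=> [y c x x'|x y|x]; last exact: v0.
    by rewrite -vl; congr (vol chi _ _ _); apply: ker_val_is_linear.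
  exact: (alt3_swap vA).
have LG x y z : L (G x y z) = vol chi x y z.
  by rewrite /G !linearD !linearZ !LE /= !vol_proj; apply: vol_section.
have Lk : L kappa = 1.
  apply/eqP; rewrite -subr_eq0; apply/eqP.
  apply: (vol_span chiA (X := R^o)) => x y z.
  by rewrite scalerBr -linearZ -GE LG regular_scale1 subrr.
exists theta; split=> //.
  exists L => [r|u]; first by rewrite linearZ /= Lk regular_scale1.
  apply: (@ext2_eq _ _ _ (theta \o L) idfun) => p q /=.
  by rewrite LE; apply: thE.
move=> theta0 theta0E r.
have [K KE] := vol_univ chiA (@wedge3_alt3 R N).
have wG x y z : wedge_with 2 (ker_incl a) e (G x y z) = vol chi x y z *: K.
  rewrite /G !linearD !linearZ !wedge_with_wedge2 !KE /=.
  by rewrite !vol_proj !scalerA -!scalerDl vol_section.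
have kK : wedge_with 2 (ker_incl a) e kappa = K.
  apply/eqP; rewrite -subr_eq0; apply/eqP/(vol_span chiA) => x y z.
  by rewrite scalerBr -linearZ -GE wG subrr.
have tK : wedge_with 2 (inl_lin P R^o) (0, 1) (theta0 1) = K.
  apply/eqP; rewrite -subr_eq0; apply/eqP/(area_span chiA) => x y.
  rewrite scalerBr -!linearZ regular_scale1 theta0E wedge_with_wedge2.
  by rewrite KE vol_top subrr.
by rewrite -[theta0 r](congr1 theta0 (regular_scale1 r)) !linearZ kK tK.
Qed.

(** Wedging with e sends theta(chi_a(p, q)) = p /\ q to an element of volume
    vol(p, q, e), whereas the compatibility of theta with theta0 sends it to
    an element of volume chi_a(p, q). *)
Lemma kernel_area_unique (theta0 : {linear R^o -> ext 2 P})
    (theta : {linear R^o -> ext 2 (ker a)}) (chi_a : ker a -> ker a -> R) :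
  (forall p q, theta0 (chi p q) = wedge2 p q) ->
  (forall r : R^o, wedge_with 2 (ker_incl a) e (theta r) =
     wedge_with 2 (inl_lin P R^o) (0, 1) (theta0 r)) ->
  (forall p q, theta (chi_a p q) = wedge2 p q) ->
  forall p q, chi_a p q = vol chi (ker_val p) (ker_val q) e.
Proof.
move=> theta0E wE thetaE p q.
have [L LE] := ext3_lift (vol_alt3 chiA).
have LwE r : L (wedge_with 2 (inl_lin P R^o) (0, 1) (theta0 r)) = r.
  rewrite -{1}[r]regular_scale1 !linearZ.
  suff -> : L (wedge_with 2 (inl_lin P R^o) (0, 1) (theta0 1)) = 1.
    exact: regular_scale1.
  apply/eqP; rewrite -subr_eq0; apply/eqP.
  apply: (area_span chiA (X := R^o)) => x y.
  rewrite scalerBr regular_scale1 -!linearZ regular_scale1 theta0E.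
  by rewrite wedge_with_wedge2 LE vol_top subrr.
by rewrite -[LHS]LwE -wE thetaE wedge_with_wedge2 LE.
Qed.
End KernelArea.

Section SymbolForm.
Context {R : comPzRingType} {P : lmodType R} (chi : P -> P -> R).
Hypothesis chiA : area_form chi.
Local Notation N := (P * R^o)%type.
Local Notation M := (P * (R^o * R^o))%type.

(** The symbol form V(a, e) on P (+) R^2, written without ker a. *)
Definition symbol_form (a : N -> R) (e : N) (m m' : M) : R :=
  vol chi (m.1, m.2.1) (m'.1, m'.2.1) e
  + (a (m.1, m.2.1) * m'.2.2 - m.2.2 * a (m'.1, m'.2.1)).

(** The two forms differ by vol(., ., e' - e).  By [vol_exchange] this is
    a(x) l(y) - l(x) a(y), which is the change caused by the transvection
    u |-> u + l(x). *)
Lemma symbol_form_change_section (a : {scalar N}) e e' l m m' :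
  a e = 1 -> a e' = 1 -> (forall x, l x = vol chi e x (e' - e)) ->
  symbol_form a e' m m' =
  symbol_form a e (m.1, (m.2.1, m.2.2 + l (m.1, m.2.1)))
               (m'.1, (m'.2.1, m'.2.2 + l (m'.1, m'.2.1))).
Proof.
move=> ae ae' lE; have vA := vol_alt3 chiA; rewrite /symbol_form /= !lE.
set x := (m.1, _); set y := (m'.1, _).
have -> : vol chi x y e' = vol chi x y e + vol chi x y (e' - e).
  rewrite -{1}[e'](addrNK e) -[e' - e]scale1r (alt3_linr vA) addrC.
  by rewrite -[1 *: _]/(1 * _) mul1r scale1r.
have := vol_exchange chiA a e x y (e' - e).
rewrite ae linearB /= ae ae' subrr mul0r addr0 mul1r => ->.
rewrite (alt3_swap vA e x); ring.
Qed.

Lemma symbol_form_pull (a : {scalar N}) (phi : N -> N) e m m' :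
  (forall x y z, vol chi (phi x) (phi y) (phi z) = vol chi x y z) ->
  symbol_form (fun x => a (phi x)) e m m' =
  symbol_form a (phi e) ((phi (m.1, m.2.1)).1, ((phi (m.1, m.2.1)).2, m.2.2))
               ((phi (m'.1, m'.2.1)).1, ((phi (m'.1, m'.2.1)).2, m'.2.2)).
Proof. by move=> phiV; rewrite /symbol_form -!surjective_pairing phiV. Qed.

Lemma pullback_symbol_form (a : Um N) (s : {linear R^o -> N}) (aK : cancel s a)
    (chi_a : altform (ker a)) m m' :
  (forall p q, chi_a p q = vol chi (ker_val p) (ker_val q) (s 1)) ->
  pullback (i_s1_bij aK) (perp chi_a psi2) m m' = symbol_form a (s 1) m m'.
Proof.
move=> chiE; case: m m' => p [u v] [p' [u' v']].
have sE r : s r = r *: s 1 by rewrite -linearZ regular_scale1.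
rewrite /= /perp_fun /= /psi2_fun /= chiE /= !(sE (a _)) vol_proj //.
Qed.
End SymbolForm.

(** * Determinants of endomorphisms of projective modules *)

Section MatrixOf.
Context {R : comPzRingType}.

(** The matrix of f in the standard bases; the definition of [is_det] is
    an instance of it. *)
Definition mx_of n m (f : 'cV[R]_n -> 'cV[R]_m) : 'M[R]_(m, n) :=
  \matrix_(k, l) f (delta_mx l 0) k 0.

Lemma mx_ofE n m (f : 'cV[R]_n -> 'cV[R]_m) v : linear f -> mx_of f *m v = f v.
Proof.
move=> fl; pose F := mk_linear fl; rewrite -[f v]/(F v).
rewrite {2}[v]matrix_sum_delta linear_sum; apply/colP => k.
rewrite mxE summxE; apply: eq_bigr => l _.
by rewrite big_ord1 linearZ !mxE mulrC.
Qed.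

Lemma mx_of_uniq n m (f : 'cV[R]_n -> 'cV[R]_m) A :
  (forall v, A *m v = f v) -> mx_of f = A.
Proof.
by move=> fA; apply/matrixP => k l; rewrite mxE -fA -colE mxE.
Qed.

(** Both sides are obtained from the determinant of the block matrix with rows
    (h, - X) and (Y, 1), by eliminating Y with column operations, or with row
    operations after scaling the lower block row by h.  For h = 1 this is
    Sylvester's identity. *)
Lemma det_scalar_add_swap h n k (X : 'M[R]_(n, k)) (Y : 'M[R]_(k, n)) :
  h ^+ k * \det (h%:M + X *m Y) = h ^+ n * \det (h%:M + Y *m X).
Proof.
pose C := block_mx h%:M (- X) Y 1%:M.
have -> : \det (h%:M + X *m Y) = \det C.
  have -> : \det C = \det (C *m block_mx 1%:M 0 (- Y) 1%:M).
    by rewrite det_mulmx det_lblock !det1 !mulr1.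
  rewrite mulmx_block !mulmx1 !mulmx0 !add0r mul1mx mulNmx mulmxN opprK subrr.
  by rewrite det_ublock det1 mulr1.
have <- : \det (block_mx 1%:M 0 (- Y) h%:M *m C) = h ^+ n * \det (h%:M + Y *m
  X).
  rewrite mulmx_block !mul1mx !mul0mx !addr0 mulmx1 !mulNmx mulmxN opprK.
  by rewrite -scalar_mxC addNr det_ublock det_scalar addrC.
by rewrite det_mulmx det_lblock det1 mul1r det_scalar.
Qed.

Lemma det_mx2 (F : nat -> nat -> R) :
  \det (\matrix_(i < 2, j < 2) F i j) = F 0%N 0%N * F 1%N 1%N - F 0%N 1%N * F
    1%N 0%N.
Proof.
rewrite (expand_det_row _ ord0) !big_ord_recl big_ord0 /cofactor !det_mx11 !mxE
  /=.
by rewrite /bump /= expr0 expr1; ring.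
Qed.

Lemma det_mx3 (F : nat -> nat -> R) :
  \det (\matrix_(i < 3, j < 3) F i j) =
    F 0%N 0%N * (F 1%N 1%N * F 2%N 2%N - F 1%N 2%N * F 2%N 1%N)
    - F 0%N 1%N * (F 1%N 0%N * F 2%N 2%N - F 1%N 2%N * F 2%N 0%N)
    + F 0%N 2%N * (F 1%N 0%N * F 2%N 1%N - F 1%N 1%N * F 2%N 0%N).
Proof.
have minor (l : 'I_3) : row' ord0 (col' l (\matrix_(i < 3, j < 3) F i j)) =
    \matrix_(i < 2, j < 2) F i.+1 (bump l j).
  by apply/matrixP => i j; rewrite !mxE.
rewrite (expand_det_row _ ord0) !big_ord_recl big_ord0 /cofactor !minor.
rewrite !(det_mx2 (fun i j => F i.+1 (bump _ j))) !mxE /= /bump /= expr0 expr1.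
by rewrite expr2; ring.
Qed.

(** The endomorphism T (+) id of P (+) ker r = R^n. *)
Definition summand_mx (P : lmodType R) n (i : P -> 'cV[R]_n) (r : 'cV[R]_n -> P)
    (T : P -> P) : 'M[R]_n :=
  mx_of (fun v => i (T (r v)) + (v - i (r v))).

Lemma summand_mxE (P : lmodType R) n (i : {linear P -> 'cV[R]_n})
    (r : {linear 'cV[R]_n -> P}) (T : {linear P -> P}) v :
  summand_mx i r T *m v = i (T (r v)) + (v - i (r v)).
Proof.
apply: mx_ofE => c u w; rewrite !linearP /= !scalerDr.
by rewrite [X in _ + X = _]addrACA [LHS]addrACA.
Qed.

(** Where h is invertible, A is up to scaling a basis of P, and the claim says
    that the determinant of T (+) id is the determinant of T in that basis.
    It follows from [det_scalar_add_swap], because h (1 + i (T - 1) r) is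
    h + (i A) (B (T - 1) r), and exchanging the factors leaves B T A. *)
Lemma det_summand_mx_local (P : lmodType R) n k (i : {linear P -> 'cV[R]_n})
    (r : {linear 'cV[R]_n -> P}) (A : {linear 'cV[R]_k -> P})
    (B : {linear P -> 'cV[R]_k}) h (T : {linear P -> P}) :
  cancel i r -> (forall p, A (B p) = h *: p) -> (forall v, B (A v) = h *: v) ->
  h ^+ (n + k) * \det (summand_mx i r T) =
    h ^+ n * \det (mx_of (fun v => B (T (A v)))).
Proof.
move=> iK AB BA.
pose f v := i (A v); have fl : linear f by move=> c u v; rewrite /f !linearP.
pose g v := B (T (r v) - r v).
have gl : linear g.
  by move=> c u v; rewrite /g -linearP; congr (B _); rewrite !linearP scalerDr
    addrACA.
rewrite addnC exprD -mulrA -detZ.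
have -> : h *: summand_mx i r T = h%:M + mx_of f *m mx_of g.
  apply/matrixP => a b.
  have E (v : 'cV_n) : h *: (summand_mx i r T *m v) = (h%:M + mx_of f *m mx_of
    g) *m v.
    rewrite summand_mxE mulmxDl -mulmxA !mx_ofE // /f /g AB linearZ linearB /=.
    by rewrite mul_scalar_mx -scalerDr; congr (_ *: _); rewrite addrCA.
  have := congr1 (fun v : 'cV_n => v a 0) (E (delta_mx b 0)).
  by rewrite scalemxAl -!colE !mxE.
rewrite det_scalar_add_swap; congr (_ * \det _); apply/esym/mx_of_uniq => v.
rewrite mulmxDl -mulmxA !mx_ofE // /f /g iK linearB /= BA mul_scalar_mx.
by rewrite addrC subrK.
Qed.
End MatrixOf.

Section SLExtension.
Context {R : comPzRingType} {P : lmodType R}.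
Local Notation N := (P * R^o)%type.
Local Notation M := (P * (R^o * R^o))%type.
Context (phi : SL N) (l : {scalar N}).

(** The composite of phi (+) 1 with a transvection; in an embedding of N (+) R
    its matrix is block triangular with diagonal blocks those of phi and 1. *)
Definition SL_ext_fun (m : M) : M :=
  let x := (m.1, m.2.1) in
  ((phi x).1, ((phi x).2, m.2.2 + l x)).

Fact SL_ext_is_linear : linear SL_ext_fun.
Proof.
move=> c [p [u v]] [p' [u' v']]; rewrite /SL_ext_fun /=.
have phiD := linearP phi c (p, u) (p', u').
have lD : l (c *: (p, u) + (p', u')) = _ := linearP l c (p, u) (p', u').
rewrite -[(c *: p + p', _)]/(c *: (p, u) + (p', u')) phiD lD.
congr (_, (_, _)).
rewrite -[c *: v]/(c * v) -[RHS]/(c * (v + l (p, u)) + (v' + l (p', u'))).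
by rewrite mulrDr addrACA.
Qed.

Fact SL_ext_bij : bijective (mk_linear SL_ext_is_linear).
Proof.
have [psi phiK psiK] := SL_bij phi.
exists (fun m : M => let x := psi (m.1, m.2.1) in (x.1, (x.2, m.2.2 - l x))).
  case=> p [u v]; rewrite /= /SL_ext_fun /= -!surjective_pairing phiK /=.
  by rewrite addrK.
case=> p [u v]; rewrite /= /SL_ext_fun /= -!surjective_pairing psiK /=.
by rewrite subrK.
Qed.

Fact SL_ext_det : is_det (mk_linear SL_ext_is_linear) 1.
Proof.
have [n [i [r [iK detE]]]] := SL_det phi.
have il : linear (fun m : M => col_mx (i (m.1, m.2.1)) (const_mx m.2.2 :
  'cV_1)).
  move=> c [p [u v]] [p' [u' v']] /=.
  rewrite -[(c *: p + p', _)]/(c *: (p, u) + (p', u')) linearP.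
  rewrite -[c *: v + v']/(c * v + v') scale_col_mx add_col_mx; congr col_mx.
  by apply/matrixP => j k; rewrite !mxE.
have rl : linear (fun w : 'cV[R]_(n + 1) =>
    ((r (usubmx w)).1, ((r (usubmx w)).2, (dsubmx w) 0 0)) : M).
  by move=> c u v; rewrite !linearP !mxE.
exists (n + 1)%N, (mk_linear il), (mk_linear rl); split.
  by case=> p [u v]; rewrite /= col_mxKu col_mxKd iK mxE.
pose L (v : 'cV_n) : 'cV[R]_1 := const_mx (l (r v)).
have Ll : linear L.
  by move=> c u v; apply/matrixP => j k; rewrite /L !linearP !mxE.
rewrite -[X in \det X]/(summand_mx (mk_linear il) (mk_linear rl)
  (mk_linear SL_ext_is_linear)) {1}/summand_mx.
rewrite (mx_of_uniq (A := block_mx (summand_mx i r phi) 0 (mx_of L) 1%:M)).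
  by rewrite det_lblock det1 mulr1 -detE.
move=> w; rewrite -[w]vsubmxK; move: (usubmx w) (dsubmx w) => u t.
rewrite mul_block_col mul0mx addr0 mul1mx summand_mxE (mx_ofE _ Ll) /=.
rewrite /SL_ext_fun /= !col_mxKu !col_mxKd -!surjective_pairing.
rewrite opp_col_mx !add_col_mx; congr col_mx.
by apply/matrixP => j k; rewrite !mxE !ord1 subrr addr0 addrC.
Qed.

Definition SL_ext : SL M := MkSL SL_ext_bij SL_ext_det.
End SLExtension.

Section Local.
Context {R : comPzRingType} {P : lmodType R} (chi : P -> P -> R).
Hypothesis chiA : area_form chi.
Context (x y : P).
Local Notation N := (P * R^o)%type.

(** [frame] and [coframe] are inverse to each other up to the factor
    chi(x, y): they trivialize P where this area is invertible. *)
Definition frame (v : 'cV[R]_2) : P := v ord0 0 *: x + v ord_max 0 *: y.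
Definition coframe (p : P) : 'cV[R]_2 :=
  \col_j [:: chi p y; chi x p]`_j.

Fact frame_is_linear : linear frame.
Proof.
move=> c u v; rewrite /frame !mxE !scalerDl scalerDr !scalerA.
by rewrite addrACA.
Qed.

Fact coframe_is_linear : linear coframe.
Proof.
move=> c u v; apply/colP => j; rewrite !mxE.
by case: (ord2E j) => -> /=; rewrite ?(areaPl chiA) ?(areaPr chiA).
Qed.

Lemma frameK p : frame (coframe p) = chi x y *: p.
Proof.
have /eqP := area_plucker chiA x y p; rewrite /frame !mxE /= -addrA addr_eq0.
by move=> /eqP ->; rewrite !(areaC chiA _ p) !scaleNr opprD !opprK addrC.
Qed.

Lemma area_frame p q :
  chi p y * chi x q - chi x p * chi q y = chi x y * chi p q.
Proof.
rewrite -(areaZl chiA (chi x y)) -frameK /frame !mxE /= (areaDl chiA) !(areaZl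
  chiA).
by rewrite (areaC chiA y q) mulrN opprK.
Qed.

Lemma coframeK v : coframe (frame v) = chi x y *: v.
Proof.
have DZ := (areaDl chiA, areaDr chiA, areaZl chiA, areaZr chiA).
apply/colP => j; rewrite !mxE /frame; case: (ord2E j) => -> /=; rewrite !DZ.
  by rewrite (area_xx chiA) mulr0 addr0 mulrC.
by rewrite (area_xx chiA) mulr0 add0r mulrC.
Qed.
End Local.

Section SpecialLinearVolume.
Context {R : comPzRingType} {P : lmodType R} (chi : P -> P -> R).
Hypothesis chiA : area_form chi.
Local Notation N := (P * R^o)%type.

(** The form vol o phi is d vol for some d.  For each area h = chi(x, y), the
    matrix of phi in the frame x, y, (0, 1) has determinant h^3 d, so that
    [det_summand_mx_local] gives h^k det(phi) = h^k d. *)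
Lemma vol_SL (phi : SL N) x y z :
  vol chi (phi x) (phi y) (phi z) = vol chi x y z.
Proof.
have [vl vc v0] := vol_alt3 chiA.
have GA : alt3 ((fun x y z => vol chi (phi x) (phi y) (phi z)) :
    N -> N -> N -> R^o).
  split=> [v w c u u'|u v w|u w]; last exact: v0.
    by rewrite linearP vl.
  exact: vc.
(* The factor d plays the role of the determinant of phi. *)
have [d dE] := vol_univ chiA GA.
suff d1 : d = 1 by rewrite dE d1 regular_scale1.
apply/eqP; rewrite -subr_eq0; apply/eqP.
apply: (area_local chiA (X := R^o)) => {}x {}y.
have [n [i [r [iK detE]]]] := SL_det phi; exists (n + 3)%N.
set h := chi x y.
pose A (v : 'cV[R]_3) : N :=
  (v ord0 0 *: x + v (inord 1) 0 *: y, v ord_max 0).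
(* The factor h in the last entry makes both composites equal to h. *)
pose B (u : N) : 'cV[R]_3 := \col_j [:: chi u.1 y; chi x u.1; h * u.2]`_j.
have Al : linear A.
  by move=> c u v; rewrite /A !mxE !scalerDl addrACA -!scalerA -!scalerDr.
have Bl : linear B.
  move=> c u v; apply/colP => j; rewrite !mxE.
  rewrite -[(c *: u + v).1]/(c *: u.1 + v.1) -[(c *: u + v).2]/(c * u.2 + v.2).
  case: (ord3E j) => -> /=; rewrite ?inordK //=.
  - by rewrite (areaPl chiA).
  - by rewrite (areaPr chiA).
  - by rewrite mulrDr mulrCA.
have AB p : A (B p) = h *: p.
  case: p => p u; rewrite /A !mxE /= inordK //=.
  have := frameK chiA x y p; rewrite /frame !mxE /= => ->.
  by [].
have BA v : B (A v) = h *: v.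
  have DZ := (areaDl chiA, areaDr chiA, areaZl chiA, areaZr chiA).
  apply/colP => j; rewrite !mxE; case: (ord3E j) => -> /=; rewrite ?inordK //=
    !DZ.
    by rewrite (area_xx chiA) mulr0 addr0 mulrC.
  by rewrite (area_xx chiA) mulr0 add0r mulrC.
have := det_summand_mx_local (A := mk_linear Al) (B := mk_linear Bl) phi iK AB
  BA.
have -> : \det (summand_mx i r phi) = 1 by rewrite [RHS]detE.
pose w j : N := phi [:: (x, 0); (y, 0); (0, 1)]`_j.
pose F i j := [:: chi (w j).1 y; chi x (w j).1; h * (w j).2]`_i.
have -> : mx_of (fun v => mk_linear Bl (phi (mk_linear Al v))) =
    \matrix_(i < 3, j < 3) F i j.
  apply/matrixP => a b; rewrite !mxE /F /w.
  suff <- : A (delta_mx b 0) = [:: (x, 0); (y, 0); (0, 1)]`_b by [].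
  rewrite /A !mxE; case: (ord3E b) => -> /=; rewrite -!val_eqE /= ?inordK //=.
  - by rewrite scale1r scale0r addr0.
  - by rewrite scale1r scale0r add0r.
  - by rewrite !scale0r addr0.
have wV : vol chi (w 0%N) (w 1%N) (w 2%N) = h * d.
  by rewrite dE vol_top.
have -> : \det (\matrix_(i < 3, j < 3) F i j) = h ^+ 3 * d.
  rewrite exprSr -mulrA -wV det_mx3 /F /= /vol.
  move: (w 0%N) (w 1%N) (w 2%N) => [p a] [q b] [s c] /=.
  transitivity (h * (a * (h * chi q s) + b * (h * chi s p) + c * (h * chi p
    q))).
    rewrite -!(area_frame chiA x y); move: a b c; rewrite /GRing.regular.
    move=> a b c; ring.
  move: a b c; rewrite /GRing.regular => a b c; ring.
rewrite mulrA -exprD mulr1 => E.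
by rewrite scalerBr regular_scale1 [X in _ - X]E; apply: subrr.
Qed.
End SpecialLinearVolume.

(** * Alternating multilinear functions and the Pfaffian *)

Section MultilinearForm.
Context {R : comPzRingType} {V : lmodType R} {N : nat}.
Implicit Types (D : ('I_N -> V) -> R) (b : 'I_N -> V).

Definition multilinear_form D : Prop := forall k b b1 b2 c,
  (forall i, i != k -> b i = b1 i /\ b i = b2 i) -> b k = c *: b1 k + b2 k ->
  D b = c * D b1 + D b2.

(** For multilinear functions it suffices to test adjacent arguments; for the
    Pfaffian, expanded along its first row, this test is the easy one. *)
Definition adjacent_alternating D : Prop :=
  forall b (i j : 'I_N), j = i.+1 :> nat -> b i = b j -> D b = 0.

Definition put b k x : 'I_N -> V := fun i => if i == k then x else b i.

Lemma put_linear D b k : multilinear_form D -> scalar (fun x => D (put b k x)).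
Proof.
move=> Dl c x y; apply: (Dl k); last by rewrite /put eqxx.
by move=> i /negbTE ik; rewrite /put ik.
Qed.

(** Polarization of the vanishing at the diagonal. *)
Lemma multilinear_swap D (i j : 'I_N) : multilinear_form D -> i != j ->
  (forall b, b i = b j -> D b = 0) ->
  forall b, D (fun k => b (tperm i j k)) = - D b.
Proof.
move=> Dl ij D0 b; have ji : j == i = false by rewrite eq_sym; apply: negbTE.
pose B x y := D (put (put b j y) i x).
have BD x x' y : B (x + x') y = B x y + B x' y.
  by rewrite -[x]scale1r /B (put_linear _ _ Dl) mul1r scale1r.
have BDr x y y' : B x (y + y') = B x y + B x y'.
  have BE z : B x z = D (put (put b i x) j z).
    congr D; apply/funext => k; rewrite /put.
    by case: (eqVneq k i) => // ->; rewrite eq_sym ji.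
  by rewrite !BE -[y]scale1r (put_linear _ _ Dl) mul1r scale1r.
have B0 x : B x x = 0 by apply: D0; rewrite /put eqxx ji eqxx.
have -> : D b = B (b i) (b j).
  congr D; apply/funext => k; rewrite /put.
  by case: (eqVneq k i) => [->|_] //; case: (eqVneq k j) => [->|].
have -> : D (fun k => b (tperm i j k)) = B (b j) (b i).
  congr D; apply/funext => k; rewrite /put.
  case: tpermP => [->|->|/eqP/negbTE -> /eqP/negbTE -> //]; first by rewrite
    eqxx.
  by rewrite ji eqxx.
apply/eqP; rewrite -addr_eq0; apply/eqP.
by have := B0 (b i + b j); rewrite BD !BDr !B0 add0r addr0 addrC.
Qed.

(** If j > i + 1, exchanging the arguments j - 1 and j brings the two equal
    arguments closer together, at the cost of a sign. *)
Lemma multilinear_alternating D :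
  multilinear_form D -> adjacent_alternating D ->
  forall b (i j : 'I_N), i != j -> b i = b j -> D b = 0.
Proof.
move=> Dl Da b i j ij.
wlog {ij} ij : i j / (i < j)%N.
  move=> H; case: (ltngtP i j) => [ltij|ltji|/val_inj E]; first exact: H.
    by move/esym; apply: H.
  by rewrite E eqxx in ij.
have [d] := ubnP (j - i); elim: d b i j ij => // d IH b i j ij dij bij.
have [jE|ltij] := eqVneq (val j) i.+1; first exact: Da jE bij.
have lti : (i.+1 < j)%N by rewrite ltn_neqAle eq_sym ltij.
have ltj : (j.-1 < N)%N by apply: leq_ltn_trans (leq_pred j) (ltn_ord j).
pose j' := Ordinal ltj.
have jS : j = j'.+1 :> nat by rewrite /= prednK // (leq_trans _ ij).
have j'j : j' != j.
  by apply/eqP => /(congr1 (@nat_of_ord N)); rewrite jS => /n_Sn.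
rewrite -[D b]opprK -(multilinear_swap Dl j'j); last by move=> c; apply: Da.
rewrite (IH _ i j') ?oppr0 //.
- by move: lti; rewrite jS.
- by move: dij ij; rewrite jS /=; lia.
- by rewrite tpermL tpermD // -val_eqE /=; lia.
Qed.

(** Replace the arguments one at a time by elements of the spanning family e.
    Once all of them are of the form e_(f i), either f repeats a value or it is
    a permutation, that is a product of transpositions. *)
Lemma multilinear_vanish D (e : 'I_N -> V) :
  multilinear_form D -> adjacent_alternating D ->
  (forall v, exists c : 'I_N -> R, v = \sum_l c l *: e l) -> D e = 0 ->
  forall b, D b = 0.
Proof.
move=> Dl Da eS De; have Dalt := multilinear_alternating Dl Da.
have Dperm (s : 'S_N) : D (fun i => e (s i)) = 0.
  have [ts -> dts] := prod_tpermP s.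
  elim: ts dts => [|t ts IH] /=.
    by move=> _; rewrite big_nil -De; congr D; apply/funext => i; rewrite perm1.
  move=> /andP[dt dts]; rewrite big_cons.
  have := multilinear_swap Dl dt (fun b bt => Dalt b _ _ dt bt)
    (fun i => e ((\prod_(t <- ts) tperm t.1 t.2)%g i)).
  rewrite IH // oppr0 => DE; rewrite -[RHS]DE; congr D; apply/funext => i.
  by rewrite permM.
suff H k b : (forall i : 'I_N, (k <= i)%N -> exists l, b i = e l) -> D b = 0.
  by move=> b; apply: (H N) => i; rewrite leqNgt ltn_ord.
elim: k b => [|k IH] b bE.
  have /choice[f fE] : forall i, exists l, b i = e l by move=> i; apply: bE.
  have -> : b = (fun i => e (f i)) by apply/funext.
  have [finj|] := boolP (injectiveb f).
    rewrite -(Dperm (perm (injectiveP _ finj))); congr D; apply/funext => i.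
    by rewrite permE.
  case/injectivePn => i [j ij fij].
  by apply: (Dalt _ _ _ ij); rewrite fij.
case: (ltnP k N) => kN; last first.
  by apply: IH => i /(leq_trans kN); rewrite leqNgt ltn_ord.
pose K := Ordinal kN; have [c bK] := eS (b K).
have -> : D b = D (put b K (\sum_l c l *: e l)).
  by congr D; apply/funext => i; rewrite /put; case: eqP => [->|].
rewrite -[LHS]/(mk_scalar (put_linear b K Dl) _) linear_sum big1 // => l _.
rewrite linearZ /= IH ?mulr0 // => i; rewrite /put; case: eqP => [_ _|iK ki].
  by exists l.
apply: bE; rewrite ltn_neqAle ki andbT; apply/eqP => E; apply: iK; exact:
  val_inj.
Qed.
End MultilinearForm.

(** The difference of both sides is multilinear and alternating in the columns
    of E, and vanishes at the standard basis. *)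
Lemma multilinear_det (R : comPzRingType) N (D : ('I_N -> 'cV[R]_N) -> R) :
  multilinear_form D -> adjacent_alternating D ->
  forall E : 'M_N, D (fun i => E *m delta_mx i 0) =
    \det E * D (fun i => delta_mx i 0).
Proof.
move=> Dl Da E; pose e i : 'cV[R]_N := delta_mx i 0.
pose m (b : 'I_N -> 'cV[R]_N) := \matrix_(i, j) b i j 0.
(* Column i of E is listed as row i here; det E is unchanged. *)
pose D' b := D b - \det (m b) * D e.
have D'0 : D' (fun i => E *m delta_mx i 0) = 0.
  apply: (multilinear_vanish (e := e)).
  - move=> k b b1 b2 c bE bk; rewrite /D' (Dl _ _ _ _ _ bE bk).
    have kl (i : 'I_N.-1) : lift k i != k by rewrite eq_sym neq_lift.
    rewrite (@determinant_multilinear _ _ (m b) (m b1) (m b2) k c 1).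
    + ring.
    + by apply/rowP => j; rewrite !mxE bk !mxE mul1r.
    + apply/matrixP => i j; rewrite !mxE.
      by have [<- _] := bE (lift k i) (kl i).
    + apply/matrixP => i j; rewrite !mxE.
      by have [_ <-] := bE (lift k i) (kl i).
  - move=> b i j ij bij; rewrite /D' (Da _ _ _ ij bij) sub0r.
    rewrite (@determinant_alternate _ _ _ i j) ?mul0r ?oppr0 //.
      by apply/eqP => E'; move: ij; rewrite E'; lia.
    by move=> k; rewrite !mxE bij.
  - move=> v; exists (fun l => v l 0).
    by rewrite {1}[v]matrix_sum_delta; apply: eq_bigr => l _; rewrite big_ord1.
  - rewrite /D'; have -> : m e = 1%:M.
      by apply/matrixP => i j; rewrite !mxE eqxx andbT eq_sym.
    by rewrite det1 mul1r subrr.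
apply/eqP; rewrite -subr_eq0 -{}D'0 /D'; apply/eqP; congr (_ - _ * _).
rewrite -[LHS]det_tr; congr (\det _); apply/matrixP => i j.
by rewrite [LHS]mxE [RHS]mxE -colE mxE.
Qed.

Section GramPfaffian.
Context {R : comPzRingType} {V : lmodType R} (f : altform V).

Definition gram m (b : 'I_m -> V) : 'M[R]_m := \matrix_(i, j) f (b i) (b j).

Lemma pfaffian_gram_rec n (b : 'I_n.+1.*2 -> V) :
  pfaffian (gram b) = \sum_(j < n.*2.+1) (-1) ^+ j
    * f (b ord0) (b (lift ord0 (j : 'I_n.*2.+1)))
    * pfaffian (gram (fun k : 'I_n.*2 => b (lift ord0 (lift j k)))).
Proof.
apply: eq_bigr => j _; rewrite mxE; congr (_ * pfaffian _).
by apply/matrixP => k l; rewrite !mxE.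
Qed.

Lemma pfaffian_gram_multilinear n :
  multilinear_form (fun b : 'I_n.*2 -> V => pfaffian (gram b)).
Proof.
elim: n => [|n IH] k b b1 b2 c bE bk; first by case: k {bk bE}.
rewrite !pfaffian_gram_rec mulr_sumr -big_split; apply: eq_bigr => j _ /=.
have [kE|[k' kE]] : k = ord0 \/ exists k', k = lift ord0 (k' : 'I_n.*2.+1).
  by case: (unliftP ord0 k) => [k' ->|->]; [right; exists k'|left].
  have E i : b (lift ord0 i) = b1 (lift ord0 i) /\ b (lift ord0 i) = b2 (lift
    ord0 i).
    by apply: bE; rewrite kE eq_sym neq_lift.
  have -> : b1 (lift ord0 j) = b (lift ord0 j) by have [] := E j.
  have -> : b2 (lift ord0 j) = b (lift ord0 j) by have [] := E j.
  have -> : (fun k0 => b1 (lift ord0 (lift j k0))) = (fun k0 => b (lift ord0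
    (lift j k0))).
    by apply/funext => i; have [] := E (lift j i).
  have -> : (fun k0 => b2 (lift ord0 (lift j k0))) = (fun k0 => b (lift ord0
    (lift j k0))).
    by apply/funext => i; have [] := E (lift j i).
  rewrite -kE bk (form_linearl f); ring.
have [b01 b02] : b ord0 = b1 ord0 /\ b ord0 = b2 ord0.
  by apply: bE; rewrite kE neq_lift.
case: (unliftP j k') => [k'' k'E|k'E].
  rewrite (IH k'' _ (fun i => b1 (lift ord0 (lift j i)))
    (fun i => b2 (lift ord0 (lift j i))) c).
  - rewrite -b01 -b02.
    have [-> ->] : b1 (lift ord0 j) = b (lift ord0 j) /\ b2 (lift ord0 j) = b
      (lift ord0 j).
      have [] // := bE (lift ord0 j) _.
      by rewrite kE k'E (inj_eq lift_inj) neq_lift.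
    ring.
  - move=> i ik; apply: bE.
    by rewrite kE k'E !(inj_eq lift_inj).
  - by rewrite -k'E -kE.
have E i : b (lift ord0 (lift j i)) = b1 (lift ord0 (lift j i)) /\
    b (lift ord0 (lift j i)) = b2 (lift ord0 (lift j i)).
  by apply: bE; rewrite kE k'E (inj_eq lift_inj) eq_sym neq_lift.
have -> : (fun k0 => b1 (lift ord0 (lift j k0))) = (fun k0 => b (lift ord0 (lift
  j k0))).
  by apply/funext => i; have [] := E i.
have -> : (fun k0 => b2 (lift ord0 (lift j k0))) = (fun k0 => b (lift ord0 (lift
  j k0))).
  by apply/funext => i; have [] := E i.
rewrite -k'E -kE bk (form_linearr f) -b01 -b02; ring.
Qed.
End GramPfaffian.

(** The predicate Q selects one member of each orbit, so that the argument is
    valid in characteristic two as well. *)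
Lemma sum_sign_reversing_eq0 (R : pzRingType) (T : finType) (s : T -> T)
    (Q : pred T) (F : T -> R) :
  involutive s -> (forall t, Q (s t) = ~~ Q t) -> (forall t, F (s t) = - F t) ->
  \sum_t F t = 0.
Proof.
move=> sK sQ sF; rewrite (bigID Q) /= [X in _ + X](reindex_inj (inv_inj sK)) /=.
rewrite [X in _ + X](eq_big Q (fun t => - F t)) => [|t|t _].
- by rewrite sumrN subrr.
- by rewrite sQ negbK.
- exact: sF.
Qed.

Section DoubleDeletion.
Context (m : nat).
Implicit Types t : 'I_m.+2 * 'I_m.+1.

(** Deleting the positions j and then l of a sequence removes the elements
    with indices j and lift j l; the map exchanges the order in which these
    two elements are removed. *)
Definition swap_deletion t : 'I_m.+2 * 'I_m.+1 :=
  let k := lift t.1 t.2 in (k, odflt t.2 (unlift k t.1)).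

Lemma swap_deletion_lift t :
  lift (swap_deletion t).1 (swap_deletion t).2 = t.1.
Proof.
rewrite /=; case: unliftP => [l tE|tE] /=; first by rewrite -tE.
by have := neq_lift t.1 t.2; rewrite -tE eqxx.
Qed.

Lemma swap_deletionK : involutive swap_deletion.
Proof.
move=> t; rewrite {1}/swap_deletion swap_deletion_lift /= liftK /=.
by case: t.
Qed.

Lemma swap_deletion_ltn t :
  ((swap_deletion t).2 < (swap_deletion t).1)%N = ~~ (t.2 < t.1)%N.
Proof.
have := congr1 val (swap_deletion_lift t); rewrite /= /bump.
move: (odflt _ _) => l'; lia.
Qed.

Lemma swap_deletion_odd t :
  odd ((swap_deletion t).1 + (swap_deletion t).2) = ~~ odd (t.1 + t.2).
Proof.
have := congr1 val (swap_deletion_lift t); rewrite /= /bump.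
move: (odflt _ _) => l'; lia.
Qed.

Lemma swap_deletion_comp t (k : 'I_m) :
  lift (swap_deletion t).1 (lift (swap_deletion t).2 k) = lift t.1 (lift t.2 k).
Proof.
apply: val_inj; have := congr1 val (swap_deletion_lift t); rewrite /= /bump.
move: (odflt _ _) => l'; lia.
Qed.
End DoubleDeletion.

Section GramAlternating.
Context {R : comPzRingType} {V : lmodType R} (f : altform V).

(** Expand along the first two rows, which belong to the equal vectors.  A term
    is given by the ordered pair of the other indices met, and exchanging the
    two changes the sign only. *)
Lemma pfaffian_gram_head n (b : 'I_n.+1.*2 -> V) (j : 'I_n.+1.*2) :
  j = 1%N :> nat -> b ord0 = b j -> pfaffian (gram f b) = 0.
Proof.
move=> j1 bj; rewrite pfaffian_gram_rec big_ord_recl.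
have -> : lift ord0 ord0 = j :> 'I_n.*2.+2 by apply: val_inj; rewrite /= j1.
rewrite -bj form_alt mulr0 mul0r add0r.
case: n b j j1 bj => [|n] b j j1 bj; first by rewrite big_ord0.
pose c (k : 'I_n.*2.+2) : V := b (lift ord0 (lift ord0 k)).
pose F (t : 'I_n.*2.+2 * 'I_n.*2.+1) : R :=
  - ((-1) ^+ (t.1 + t.2) * (f (b j) (c t.1) * f (b j) (c (lift t.1 t.2)))
    * pfaffian (gram f (fun k : 'I_n.*2 => c (lift t.1 (lift t.2 k))))).
have FE (k : 'I_n.*2.+2) : (-1) ^+ lift ord0 k * f (b j) (b (lift ord0 (lift
  ord0 k)))
    * pfaffian (gram f (fun l : 'I_n.+1.*2 => b (lift ord0 (lift (lift ord0 k)
      l))))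
    = \sum_(l < n.*2.+1) F (k, l).
  rewrite pfaffian_gram_rec mulr_sumr; apply: eq_bigr => l _.
  have -> : lift (lift ord0 k) ord0 = ord0 :> 'I_n.*2.+3 by apply: val_inj.
  have -> : lift ord0 ord0 = j :> 'I_n.*2.+4 by apply: val_inj; rewrite /= j1.
  have liftE (i : 'I_n.*2.+1) :
      lift (lift ord0 k) (lift ord0 i) = lift ord0 (lift k i) :> 'I_n.*2.+3.
    by apply: val_inj; rewrite /= /bump; lia.
  rewrite liftE /F /=.
  have -> : (fun i => b (lift ord0 (lift (lift ord0 k) (lift ord0 (lift l i)))))
    =
    (fun i => c (lift k (lift l i))) by apply/funext => i; rewrite liftE.
  by rewrite /bump leq0n add1n exprS exprD /c; ring.
rewrite bj (eq_bigr _ (fun k _ => FE k)) pair_big /=.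
rewrite (eq_bigr F) => [|[] //].
pose Q (t : 'I_n.*2.+2 * 'I_n.*2.+1) := (t.2 < t.1)%N.
apply: (sum_sign_reversing_eq0 (@swap_deletionK n.*2) (Q := Q)).
  exact: swap_deletion_ltn.
move=> t; rewrite /F.
have -> : (fun k => c (lift (swap_deletion t).1 (lift (swap_deletion t).2 k))) =
    (fun k => c (lift t.1 (lift t.2 k))).
  by apply/funext => k; rewrite swap_deletion_comp.
rewrite swap_deletion_lift -[LHS]opprK; congr (- - _).
rewrite -signr_odd swap_deletion_odd -[in RHS]signr_odd.
rewrite [f _ _ * _]mulrC; case: (odd _) => /=; rewrite ?expr0 ?expr1; ring.
Qed.

(** In the expansion along the first row, every term that keeps both equal
    vectors vanishes by induction, and the two remaining terms cancel. *)
Lemma pfaffian_gram_alternating n :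
  adjacent_alternating (fun b : 'I_n.*2 -> V => pfaffian (gram f b)).
Proof.
elim: n => [|n IH] b i j ij bij; first by case: i {ij bij}.
have [i' iE|iE] := unliftP ord0 i; last first.
  by apply: (pfaffian_gram_head (j := j)); rewrite ?ij -?bij iE.
have [j' jE|jE] := unliftP ord0 j; last by move: ij; rewrite jE.
have ij' : j' = i'.+1 :> nat by move: ij; rewrite iE jE /= /bump; lia.
have i'j' : i' != j' by apply/eqP => E; move: ij'; rewrite E; lia.
rewrite pfaffian_gram_rec (bigD1 i') //= (bigD1 j') 1?eq_sym //=.
rewrite big1 ?addr0 => [|t /andP[ti tj]]; last first.
  have [i'' i''E] : exists k : 'I_n.*2, i' = lift t k.
    by have [k ->] := unlift_some ti; exists k.
  have [j'' j''E] : exists k : 'I_n.*2, j' = lift t k.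
    by have [k ->] := unlift_some tj; exists k.
  rewrite (IH _ i'' j'') ?mulr0 //; last by rewrite -i''E -j''E -iE -jE.
  have vi : i' = bump t i'' :> nat by rewrite i''E.
  have vj : j' = bump t j'' :> nat by rewrite j''E.
  by move: ij' vi vj; rewrite /bump; lia.
have -> : (fun k : 'I_n.*2 => b (lift ord0 (lift j' k))) =
    (fun k : 'I_n.*2 => b (lift ord0 (lift i' k))).
  apply/funext => k.
  have vi : lift i' k = bump i' k :> nat by [].
  have vj : lift j' k = bump j' k :> nat by [].
  move: vi vj; rewrite /bump; have [ki|ki] := eqVneq (k : nat) i' => vi vj.
    have -> : lift j' k = i' by apply: ord_inj; lia.
    have -> : lift i' k = j' by apply: ord_inj; lia.
    by rewrite -iE -jE.
  by have -> : lift j' k = lift i' k by apply: ord_inj; lia.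
by rewrite -iE -jE bij ij' exprS; ring.
Qed.
End GramAlternating.

Lemma pfaffian_pull (R : comPzRingType) n (f : altform 'cV[R]_(n.*2))
    (E : 'M_(n.*2)) :
  pfaffian (\matrix_(i, j) f (E *m delta_mx i 0) (E *m delta_mx j 0)) =
    \det E * pfaffian (\matrix_(i, j) f (delta_mx i 0) (delta_mx j 0)).
Proof.
exact: (multilinear_det (@pfaffian_gram_multilinear _ _ f n)
  (@pfaffian_gram_alternating _ _ f n) E).
Qed.

(** * Relations in V_SL and orthogonal complements *)

Section VSLRelations.
Context {R : comPzRingType}.
Local Notation rel := (@VSL_rel R).

(** An idempotent of a group is trivial. *)
Lemma pres_idem_nil (A : pzRingType) (G : Type)
    (r : seq (A * G) -> seq (A * G) -> Prop) s :
  pres r (s ++ s) s -> pres r s [::].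
Proof.
move=> ss; have sN : pres r (s ++ fscale (-1) s) [::].
  rewrite -[s in s ++ _]fscale1; apply: pres_trans (pres_fscale0 r s).
  by rewrite -(subrr 1); apply/pres_sym/pres_fscaleD.
apply: pres_trans (sN); apply: pres_trans (pres_cat ss (pres_refl _ _)).
rewrite -catA -[X in pres _ X _](cats0 s).
by apply: pres_cat; [apply: pres_refl|apply: pres_sym].
Qed.

Lemma VSL_relE s t : rel s t -> pres rel s t.
Proof. by move=> st; have := pres_rel 1 st; rewrite !fscale1. Qed.

Lemma VSL_class_isometric (s t : triple R) : isometric s t -> VSL_class s =
  VSL_class t.
Proof. by move=> st; apply/VSL_piP/VSL_relE/VSL_isometric. Qed.

Lemma VSL_class_SL (P : lmodType R) (hP : fg_projective P) (g f : altform P)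
    (phi : SL P) :
  VSL_class (Triple hP g f) = VSL_class (Triple hP g (pullback (SL_bij phi) f)).
Proof. apply/VSL_piP; apply: VSL_relE; exact: VSL_SL. Qed.

(** By relation (2) the triple (Q, g, g) is idempotent, hence zero. *)
Lemma VSL_class_stable (P Q : lmodType R) (hP : fg_projective P)
    (hQ : fg_projective Q) (f0 f1 : altform P) (g : altform Q) :
  VSL_class (Triple hP f0 f1) =
  VSL_class (Triple (prod_fg_projective hP hQ) (perp f0 g) (perp f1 g)).
Proof.
apply/VSL_piP/pres_sym; apply: pres_trans (VSL_relE (VSL_perp _ _ _ _ _ _)) _.
rewrite -[X in pres _ _ X]cats0 -cat1s.
apply: pres_cat; first exact: pres_refl.
by apply: pres_idem_nil; apply/VSL_relE/VSL_comp.
Qed.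
End VSLRelations.

Lemma fg_projective_retract (R : comPzRingType) (P Q : lmodType R)
    (j : {linear Q -> P}) (s : {linear P -> Q}) :
  cancel j s -> fg_projective P -> fg_projective Q.
Proof.
move=> jK [[n [g gs]] Pproj]; split.
  exists n, (s \o g) => q; have [v gv] := gs (j q).
  by exists v; rewrite /= gv jK.
move=> X Y u f us; have [h hE] := Pproj X Y u (f \o s) us.
by exists (h \o j) => q; rewrite /= hE /= jK.
Qed.

Section LinearKernel.
Context {R : comPzRingType} {M N : lmodType R} (g : {linear M -> N}).

Definition lin_ker_pred : {pred M} := fun x => g x == 0.

Fact lin_ker_submod_closed : submod_closed lin_ker_pred.
Proof.
split; first by rewrite unfold_in linear0.
by move=> c u v; rewrite !unfold_in linearP => /eqP -> /eqP ->; rewrite scaler0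
  addr0.
Qed.

HB.instance Definition _ :=
  GRing.isSubmodClosed.Build R M lin_ker_pred lin_ker_submod_closed.

Record lin_ker := LinKer { lin_ker_val : M; lin_ker_valP : lin_ker_val \in
  lin_ker_pred }.

HB.instance Definition _ := [isSub for lin_ker_val].
HB.instance Definition _ := [Choice of lin_ker by <:].
HB.instance Definition _ := [SubChoice_isSubLmodule of lin_ker by <:].

Fact lin_ker_val_is_linear : linear lin_ker_val.
Proof. by move=> c u v; rewrite -[lin_ker_val]/(val) linearP. Qed.

Lemma lin_ker_val0 q : g (lin_ker_val q) = 0.
Proof. exact/eqP/lin_ker_valP. Qed.
End LinearKernel.

Section SymplecticComplement.
Context {R : comPzRingType} {P V : lmodType R} (chi : altform P).
Context (Psi : altform V) (i : {linear P -> V}).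
Hypothesis i_isom : forall p q, Psi (i p) (i q) = chi p q.

Lemma altformC (W : lmodType R) (f : altform W) x y : f y x = - f x y.
Proof.
have D u v w : f (u + v) w = f u w + f v w.
  by rewrite -[u]scale1r form_linearl mul1r scale1r.
have Dr u v w : f w (u + v) = f w u + f w v.
  by rewrite -[u]scale1r form_linearr mul1r scale1r.
apply/eqP; rewrite -addr_eq0; apply/eqP.
by have := form_alt f (x + y); rewrite D !Dr !form_alt add0r addr0 addrC.
Qed.

Lemma form_adjoint : exists r : {linear V -> P},
  forall v p, chi (r v) p = Psi v (i p).
Proof.
have l v : scalar (fun p => Psi v (i p)).
  by move=> c x y; rewrite linearP form_linearr.
have /choice[r rE] v : exists p, forall q, chi p q = Psi v (i q).
  by have [p [pE _]] := form_nondeg chi (mk_scalar (l v)); exists p.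
have rl : linear r.
  move=> c u v; pose g := mk_scalar (l (c *: u + v)).
  have [p [_ pU]] := form_nondeg chi g.
  rewrite -(pU (r (c *: u + v))) ?(pU (c *: r u + r v)) // => q.
  by rewrite /= !form_linearl !rE.
by exists (mk_linear rl).
Qed.

Context (r : {linear V -> P}).
Hypothesis rE : forall v p, chi (r v) p = Psi v (i p).

Lemma adjointK : cancel i r.
Proof.
move=> p; have [x [_ xU]] := form_nondeg chi (mk_scalar (form_linearr chi p)).
by transitivity x; last exact: xU; apply/esym; apply: xU => q; rewrite rE
  i_isom.
Qed.

Local Notation Q := (lin_ker r).

Lemma form_image_kernel p q : Psi (i p) (lin_ker_val (q : Q)) = 0.
Proof.
rewrite altformC -rE lin_ker_val0.
by rewrite -[LHS]/(- mk_scalar (form_linearl chi p) 0) linear0 oppr0.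
Qed.

Definition complement_form (q q' : Q) : R := Psi (lin_ker_val q) (lin_ker_val
  q').

Fact ker_part_subproof v : v - i (r v) \in lin_ker_pred r.
Proof. by rewrite unfold_in linearB adjointK subrr. Qed.

Definition ker_part v : Q := LinKer (ker_part_subproof v).

Fact ker_part_is_linear : linear ker_part.
Proof.
move=> c u v; apply: val_inj; rewrite -[RHS]/(lin_ker_val _)
  lin_ker_val_is_linear /=.
by rewrite !linearP [LHS]addrACA -scalerDr.
Qed.

Lemma ker_partK q : ker_part (lin_ker_val q) = q.
Proof. by apply: val_inj; rewrite /= lin_ker_val0 linear0 subr0. Qed.

(** A functional on the kernel of r extends by zero on i(P); the vector that
    represents the extension is orthogonal to i(P), that is, lies in the
    kernel. *)
Lemma complement_nondeg (h : {scalar Q}) :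
  exists! q, forall q', complement_form q q' = h q'.
Proof.
have hl : scalar (fun v => h (ker_part v)).
  by move=> c u v; rewrite ker_part_is_linear linearP.
have PsiD u v w : Psi (u - v) w = Psi u w - Psi v w.
  by rewrite -[u - v]addrC -scaleN1r form_linearl mulN1r addrC.
have [v [vE vU]] := form_nondeg Psi (mk_scalar hl).
have rv0 : r v = 0.
  have [x [_ xU]] := form_nondeg chi (mk_scalar (form_linearr chi (r v))).
  transitivity x; first by apply/esym; apply: xU.
  apply: xU => p /=.
  rewrite rE vE /= -[LHS]/(mk_scalar (form_linearl chi p) 0) linear0.
  have -> : ker_part (i p) = 0.
    by apply: val_inj; rewrite /= adjointK subrr.
  by rewrite linear0.
have vq : lin_ker_val (ker_part v) = v by rewrite /= rv0 linear0 subr0.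
exists (ker_part v); split=> [q'|q qE].
  by rewrite /complement_form vq vE /= ker_partK.
apply: val_inj; rewrite -[LHS]/(lin_ker_val _) vq; apply: vU => u /=.
rewrite -qE /complement_form /= [RHS]altformC PsiD.
by rewrite form_image_kernel subr0 -altformC.
Qed.

(** The orthogonal complement of i(P), as the kernel of the adjoint r of i. *)
Definition complement : altform Q.
Proof.
refine (@AltForm _ _ complement_form _ _ _ complement_nondeg).
- by move=> q c u v; rewrite /complement_form lin_ker_val_is_linear
  form_linearl.
- by move=> q c u v; rewrite /complement_form lin_ker_val_is_linear
  form_linearr.
- by move=> q; apply: form_alt.
Defined.

Lemma complement_fg_projective : fg_projective V -> fg_projective Q.
Proof.
apply: (@fg_projective_retract _ _ _ (mk_linear (@lin_ker_val_is_linear _ _ _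
  r))
  (mk_linear ker_part_is_linear)).
exact: ker_partK.
Qed.
End SymplecticComplement.

(** * Embedding an area form into a standard symplectic form *)

Section StandardForm.
Context {R : comPzRingType}.

(** The standard form puts the new hyperbolic plane first, so that R^(2n+2)
    is cut into R^2 and R^(2n). *)
Definition pack n (u : 'cV[R]_2) (v : 'cV[R]_(n.*2)) : 'cV[R]_(n.+1.*2) :=
  col_mx u v.
Definition head2 n (w : 'cV[R]_(n.+1.*2)) : 'cV[R]_2 :=
  usubmx (w : 'cV_(2 + n.*2)).
Definition tail2 n (w : 'cV[R]_(n.+1.*2)) : 'cV[R]_(n.*2) :=
  dsubmx (w : 'cV_(2 + n.*2)).

Lemma pack_head2 n (u : 'cV_2) (v : 'cV_(n.*2)) : head2 (pack u v) = u.
Proof. exact: col_mxKu. Qed.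

Lemma pack_tail2 n (u : 'cV_2) (v : 'cV_(n.*2)) : tail2 (pack u v) = v.
Proof. exact: col_mxKd. Qed.

Lemma packK n (w : 'cV_(n.+1.*2)) : pack (head2 w) (tail2 w) = w.
Proof. exact: (vsubmxK (w : 'cV_(2 + n.*2))). Qed.

Lemma head2_is_linear n : linear (@head2 n).
Proof. by move=> c u v; apply: (linearP (@usubmx R 2 n.*2 1)). Qed.

Lemma tail2_is_linear n : linear (@tail2 n).
Proof. by move=> c u v; apply: (linearP (@dsubmx R 2 n.*2 1)). Qed.

Lemma packP n c (u u' : 'cV_2) (v v' : 'cV_(n.*2)) :
  pack (c *: u + u') (c *: v + v') = c *: pack u v + pack u' v'.
Proof.
have E : c *: (col_mx u v : 'cV_(2 + n.*2)) + col_mx u' v' =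
  col_mx (c *: u + u') (c *: v + v') by rewrite scale_col_mx add_col_mx.
exact: esym E.
Qed.

Definition col2 (a b : R) : 'cV[R]_2 := \col_j [:: a; b]`_j.

Definition plane_form (u u' : 'cV[R]_2) : R :=
  u ord0 0 * u' ord_max 0 - u ord_max 0 * u' ord0 0.

Lemma mxform_psiS n u u' v v' :
  mxform (psi n.+1) (pack u v) (pack u' v') =
  plane_form u u' + mxform (psi n) v v'.
Proof.
rewrite /= /mxform_fun /= /pack -[n.+1.*2]/(2 + n.*2)%N.
rewrite tr_col_mx mul_row_block !mulmx0 addr0 add0r mul_row_col mxE; congr (_ +
  _).
rewrite mxE !big_ord_recl big_ord0 !mxE !big_ord_recl !big_ord0 !mxE
  /plane_form.
have -> : lift ord0 ord0 = ord_max :> 'I_2 by apply: val_inj.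
by rewrite /=; ring.
Qed.

(** Row k of the left inverse is the vector representing the k-th coordinate;
    being alternating, the matrix then has a two-sided inverse. *)
Lemma altform_mx n (f : altform 'cV[R]_(n.*2)) : exists M : altmx n,
  (M = \matrix_(i, j) f (delta_mx i 0) (delta_mx j 0) :> 'M_(n.*2)) /\
  forall x y, mxform M x y = f x y.
Proof.
pose e i : 'cV[R]_(n.*2) := delta_mx i 0.
pose M := \matrix_(i, j) f (e i) (e j).
have fE x y : f x y = (x^T *m M *m y) 0 0.
  pose fx := mk_scalar (form_linearr f x).
  rewrite -[LHS]/(fx y) {1}[y]matrix_sum_delta linear_sum mxE.
  apply: eq_bigr => j _; rewrite big_ord1 linearZ mulrC /=; congr (_ * _).
  pose fe := mk_scalar (form_linearl f (delta_mx j 0)).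
  rewrite -[LHS]/(fe x) {1}[x]matrix_sum_delta linear_sum mxE.
  by apply: eq_bigr => k _; rewrite big_ord1 linearZ !mxE.
have Malt : alternating_mx M.
  split=> [|i]; last by rewrite mxE form_alt.
  by apply/matrixP => i j; rewrite !mxE altformC.
have /choice[N NE] (k : 'I_(n.*2)) : exists x, forall v, f x v = v k 0.
  have l : scalar (fun v : 'cV[R]_(n.*2) => v k 0) by move=> c u v; rewrite
    !mxE.
  by have [x [xE _]] := form_nondeg f (mk_scalar l); exists x.
pose L := \matrix_(i, j) N i j 0.
have LM : L *m M = 1%:M.
  apply/matrixP => i j.
  have := NE i (e j); rewrite fE -colE mxE [RHS in _ = RHS -> _]mxE eqxx andbT
    => E.
  rewrite [RHS]mxE -E [LHS]mxE [RHS]mxE; apply: eq_bigr => k _.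
  by rewrite !mxE.
have ML : M *m - L^T = 1%:M.
  apply: trmx_inj; rewrite trmx_mul trmx1 linearN /= trmxK (proj1 Malt).
  by rewrite mulmxN mulNmx opprK.
have Minv : invertible_mx M.
  exists L; split=> //; suff -> : L = - L^T by [].
  by rewrite -[LHS]mulmx1 -ML mulmxA LM mul1mx.
by exists (AltMx Malt Minv); split=> // x y; rewrite fE.
Qed.
End StandardForm.

Section Embedding.
Context {R : comPzRingType} {P : lmodType R} (chi : P -> P -> R).
Hypothesis chiA : area_form chi.

(** Each term c chi(x, y) of a sum equal to 1 contributes the hyperbolic
    plane with coordinates c chi(p, y) and chi(x, p). *)
Lemma symplectic_embedding :
  exists n (i : {linear P -> 'cV[R]_(n.*2)}),
    forall p q, mxform (psi n) (i p) (i q) = chi p q.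
Proof.
have [s s1] := area_unit chiA.
suff [n [i iE]] : exists n (i : {linear P -> 'cV[R]_(n.*2)}), forall p q,
    mxform (psi n) (i p) (i q) =
    (\sum_(t <- s) t.1 * chi t.2.1 t.2.2) * chi p q.
  by exists n, i => p q; rewrite iE s1 mul1r.
elim: s {s1} => [|[c [x y]] s [n [i iE]]].
  have l : linear (fun _ : P => 0 : 'cV[R]_(0.*2)).
    by move=> c u v; rewrite scaler0 addr0.
  exists 0%N, (mk_linear l) => p q.
  by rewrite big_nil mul0r /= /mxform_fun mulmx0 mxE.
have l : linear (fun p => pack (col2 (c * chi p y) (chi x p)) (i p)).
  move=> a u v; rewrite -packP linearP; congr pack; apply/colP => j; rewrite
    !mxE.
  case: (ord2E j) => -> /=; last by rewrite (areaPr chiA).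
  by rewrite (areaPl chiA); ring.
exists n.+1, (mk_linear l) => p q.
rewrite mxform_psiS iE big_cons mulrDl; congr (_ + _).
by rewrite /plane_form !mxE /= -[RHS]mulrA -(area_frame chiA x y p q); ring.
Qed.
End Embedding.

(** * The Pfaffian of the symbol form *)

Section BlockMatrices.
Context {R : comPzRingType} {n : nat}.

Definition lower_mx (f : 'cV[R]_2 -> 'cV[R]_(n.*2)) : 'M[R]_(n.+1.*2) :=
  block_mx (1%:M : 'M_2) 0 (mx_of f) 1%:M.

Definition upper_mx (A : 'M[R]_2) (g : 'cV[R]_(n.*2) -> 'cV[R]_2)
    (D : 'M[R]_(n.*2)) : 'M[R]_(n.+1.*2) :=
  block_mx A (mx_of g) 0 D.

Lemma det_lower_mx f : \det (lower_mx f) = 1.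
Proof. by rewrite [LHS](det_lblock (1%:M : 'M_2)) !det1 mulr1. Qed.

Lemma det_upper_mx A g D : \det (upper_mx A g D) = \det A * \det D.
Proof. exact: (det_ublock A (mx_of g) D). Qed.

Lemma lower_mxE f w : linear f ->
  lower_mx f *m w = pack (head2 w) (f (head2 w) + tail2 w).
Proof.
move=> fl; rewrite -{1}[w]packK.
by rewrite [LHS](mul_block_col (1%:M : 'M_2)) mul0mx addr0 !mul1mx mx_ofE.
Qed.

Lemma upper_mxE A g D w : linear g ->
  upper_mx A g D *m w = pack (A *m head2 w + g (tail2 w)) (D *m tail2 w).
Proof.
move=> gl; rewrite -{1}[w]packK.
by rewrite [LHS](mul_block_col A) mul0mx add0r mx_ofE.
Qed.
End BlockMatrices.

Section SymbolPfaffian.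
Context {R : comPzRingType} {P : lmodType R} (chi : altform P).
Hypothesis chiA : area_form chi.
Local Notation N := (P * R^o)%type.
Local Notation M := (P * (R^o * R^o))%type.
Local Notation top := ((0, 1) : N).

(** Gram-Schmidt, scaled by c = a(0, 1) to avoid division: the correction terms
    make the image of P orthogonal to the last two coordinates.  What remains
    on P is c (c e_2 + chi(pi, e_1)) chi = c a(e) chi. *)
Lemma symbol_form_diagonalize (a : {scalar N}) e pi p p' r r' u u' :
  a e = 1 -> (forall p, chi pi p = a (p, 0)) ->
  symbol_form chi a e
    (a top *: p, (r - chi pi p, u + chi e.1 p))
    (a top *: p', (r' - chi pi p', u' + chi e.1 p')) =
  a top * (chi p p' + (r * u' - u * r')).
Proof.
move=> ae piE; have aE x : a x = chi pi x.1 + x.2 * a top.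
  by rewrite {1}[x]prod_split linearD linearZ piE.
have pl := area_plucker_scalar chiA (mk_scalar (form_linearr chi pi)) p p' e.1.
move: ae; rewrite /= in pl; rewrite /symbol_form /vol /= (aE e).
rewrite (aE (a top *: p, _)) (aE (a top *: p', _)) /=.
rewrite !(areaZl chiA) !(areaZr chiA) (areaC chiA e.1 p').
move: pl; rewrite (areaC chiA e.1 p').
move: (a top) e.2; rewrite /GRing.regular => c er.
move: (chi p p') (chi pi p) (chi pi p') (chi e.1 p) (chi e.1 p') (chi pi e.1).
move=> X A A' B B' E pl e1; apply: subr0_eq.
transitivity (c * X * (E + er * c - 1) - c * (X * E + - B' * A + B * A')).
  ring.
by rewrite pl e1 subrr !mulr0 subrr.
Qed.

(** These automorphisms change the value of a at (0, 1) into a(p0, 1). *)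
Definition shear p0 (x : N) : N := (x.1 + x.2 *: p0, x.2).

Fact shear_scalar (a : {scalar N}) p0 : scalar (fun x => a (shear p0 x)).
Proof.
move=> c x y; rewrite -linearP; congr (a _).
congr (_, _); rewrite -[LHS]/(c *: x.1 + y.1 + (c * x.2 + y.2) *: p0) /=.
by rewrite scalerDl -scalerA addrACA -scalerDr.
Qed.

Lemma vol_shear p0 x y z :
  vol chi (shear p0 x) (shear p0 y) (shear p0 z) = vol chi x y z.
Proof.
rewrite /vol /shear /= !(areaDl chiA) !(areaDr chiA) !(areaZl chiA) !(areaZr
  chiA).
rewrite !(area_xx chiA) (areaC chiA x.1 p0) (areaC chiA y.1 p0) (areaC chiA z.1
  p0).
move: x.2 y.2 z.2; rewrite /GRing.regular => rx ry rz; ring.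
Qed.

Context (n : nat) (i : {linear P -> 'cV[R]_(n.*2)}).
Hypothesis i_isom : forall p q, mxform (psi n) (i p) (i q) = chi p q.
Context (r : {linear 'cV[R]_(n.*2) -> P}).
Hypothesis rE : forall v p, chi (r v) p = mxform (psi n) v (i p).
Let rK : cancel i r := adjointK i_isom rE.

(** The component in P (+) R^2 under R^(2n+2) = (P (+) R^2) (+) ker r. *)
Definition split_off (w : 'cV[R]_(n.+1.*2)) : M :=
  (r (tail2 w), (head2 w ord0 0, head2 w ord_max 0)).

Let rest (v : 'cV[R]_(n.*2)) := v - i (r v).

Let r_rest v : r (rest v) = 0.
Proof. by rewrite /rest linearB rK subrr. Qed.

Let r_sum p v : r (i p + rest v) = p.
Proof. by rewrite linearD rK r_rest addr0. Qed.

Let rest_sum p v : rest (i p + v) = rest v.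
Proof. by rewrite /rest linearD rK linearD opprD addrACA subrr add0r. Qed.

Let rest_rest v : rest (rest v) = rest v.
Proof. by rewrite {1}/rest r_rest linear0 subr0. Qed.

Lemma psi_sum p p' v v' :
  mxform (psi n) (i p + rest v) (i p' + rest v') =
  chi p p' + mxform (psi n) (rest v) (rest v').
Proof.
have il q w : mxform (psi n) (i q) (rest w) = 0.
  rewrite altformC -rE r_rest.
  by rewrite -[LHS]/(- mk_scalar (form_linearl chi q) 0) linear0 oppr0.
have D u u' w : mxform (@psi R n) (u + u') w = mxform (@psi R n) u w + mxform
  (@psi R n) u' w.
  by rewrite -[u]scale1r form_linearl mul1r scale1r.
have Dr u u' w : mxform (@psi R n) w (u + u') = mxform (@psi R n) w u + mxform
  (@psi R n) w u'.
  by rewrite -[u]scale1r form_linearr mul1r scale1r.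
rewrite (D (i p)) !(Dr (i p')) i_isom il addr0; congr (_ + _).
by rewrite altformC il oppr0 add0r.
Qed.

Context (a : {scalar N}) (e : N) (ae : a e = 1).
Context (F : altform 'cV[R]_(n.+1.*2)).
Hypothesis FE : forall w w', F w w' =
  symbol_form chi a e (split_off w) (split_off w')
  + mxform (psi n) (rest (tail2 w)) (rest (tail2 w')).

Let pf := pfaffian (\matrix_(k, l) F (delta_mx k 0) (delta_mx l 0)).

(** Put c = a(p0, 1) and h = chi(x, y).  The symbol form pulled back along
    T1, a shear followed by a scaled Gram-Schmidt, and the form chi _|_ psi_2
    pulled back along T2 are both c h^2 chi _|_ c psi_2.  Here T2 multiplies
    one coordinate of the frame x, y and one coordinate of R^2 by c.  Hence
    det(T1) pf = det(T2); computed in the frame, both determinants are c^2 h^2,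
    which leaves c^2 h^m (pf - 1) = 0. *)
Lemma symbol_pfaffian_local p0 x y : exists k m,
  a (p0, 1) ^+ k * chi x y ^+ m * (pf - 1) = 0.
Proof.
set c := a (p0, 1); set h := chi x y.
pose a' := mk_scalar (shear_scalar a p0).
(* The section value that corresponds to e under the shear. *)
pose e' : N := (e.1 - e.2 *: p0, e.2).
have se : shear p0 e' = e.
  by rewrite /shear /= subrK; case: (e).
have ae' : a' e' = 1 by rewrite /= se.
have a't : a' top = c by rewrite /= /shear /= scale1r add0r.
have [pi [piE _]] : exists! pi, forall p, chi pi p = a' (p, 0).
  have l : scalar (fun p : P => a' (p, 0)).
    by move=> d u v; rewrite -linearP (inl_is_linear R^o).
  by have [pi H] := form_nondeg chi (mk_scalar l); exists pi.
pose g v := col2 (- chi pi (h *: r v)) (chi e'.1 (h *: r v)).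
have gl : linear g.
  move=> d u v; apply/colP => j; rewrite !mxE.
  rewrite linearP scalerDr (scalerA h d) (mulrC h d) -(scalerA d h).
  by case: (ord2E j) => -> /=; rewrite ?(areaPr chiA) //; ring.
have sl : linear (fun u : 'cV[R]_2 => i (u ord0 0 *: p0)).
  by move=> d u v; rewrite -linearP !mxE scalerDl scalerA.
have Tl : linear (fun p : P => (c * h) *: p).
  by move=> d u v; rewrite scalerDr !scalerA [_ * d]mulrC.
pose fr := mk_linear (frame_is_linear x y).
pose cf := mk_linear (coframe_is_linear chiA x y).
(* The diagonal matrix (c, 1), which has determinant c. *)
pose dgf k l : R := if k != l :> nat then 0 else if k == 0%N then c else 1.
pose dg : 'M[R]_2 := \matrix_(k < 2, l < 2) dgf k l.
have dgE u : dg *m u = col2 (c * u ord0 0) (u ord_max 0).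
  apply/colP => k; rewrite !mxE !big_ord_recl big_ord0 !mxE.
  have -> : lift ord0 ord0 = ord_max :> 'I_2 by apply: val_inj.
  by case: (ord2E k) => ->; rewrite /dgf /= ?mul0r ?mul1r ?add0r ?addr0.
have taul : linear (fun p : P => fr (dg *m cf p)).
  by move=> d u v; rewrite !linearP.
(* E1 and E2 are T1 (+) id and T2 (+) id on (P (+) R^2) (+) ker r. *)
pose E1 := lower_mx (fun u : 'cV[R]_2 => i (u ord0 0 *: p0)) *m
  upper_mx 1%:M g (summand_mx i r (mk_linear Tl)).
pose E2 := upper_mx dg (fun=> 0) (summand_mx i r (mk_linear taul)).
have chiZ := (areaZl chiA, areaZr chiA).
have FE1 w w' : F (E1 *m w) (E1 *m w') = mxform (psi n.+1) (E2 *m w) (E2 *m w').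
  have E1E z : E1 *m z = pack (head2 z + g (tail2 z))
      (i ((head2 z + g (tail2 z)) ord0 0 *: p0 + (c * h) *: r (tail2 z))
       + rest (tail2 z)).
    rewrite -mulmxA upper_mxE // lower_mxE // pack_head2 pack_tail2 mul1mx.
    by rewrite summand_mxE /= linearD addrA.
  have E2E z : E2 *m z = pack (col2 (c * head2 z ord0 0) (head2 z ord_max 0))
      (i (fr (dg *m cf (r (tail2 z)))) + rest (tail2 z)).
    rewrite upper_mxE; last by move=> d u v; rewrite scaler0 addr0.
    by rewrite addr0 dgE summand_mxE.
  have s1 z : split_off (E1 *m z) =
      let m := (c *: (h *: r (tail2 z)),
         (head2 z ord0 0 - chi pi (h *: r (tail2 z)),
          head2 z ord_max 0 + chi e'.1 (h *: r (tail2 z)))) in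
      ((shear p0 (m.1, m.2.1)).1, ((shear p0 (m.1, m.2.1)).2, m.2.2)).
    rewrite E1E /split_off pack_head2 pack_tail2 r_sum /shear /= !mxE /=
      scalerA.
    by rewrite [X in (X, _)]addrC.
  have s2 z : rest (tail2 (E1 *m z)) = rest (tail2 z).
    by rewrite E1E pack_tail2 rest_sum rest_rest.
  rewrite FE !s2 !s1 -{1}se -symbol_form_pull; last exact: vol_shear.
  rewrite -a't (symbol_form_diagonalize (a := a')) // a't !E2E mxform_psiS
    psi_sum [RHS]addrA.
  congr (_ + _); rewrite /plane_form ![col2 _ _ _ _]mxE /=.
  rewrite !dgE /fr /cf /= /frame !mxE /= !(areaDl chiA) !(areaDr chiA) !chiZ.
  rewrite !(area_xx chiA) -/h (areaC chiA x y) -/h.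
  have := area_frame chiA x y (r (tail2 w)) (r (tail2 w')); rewrite -/h => <-.
  ring.
have frcf p : fr (cf p) = h *: p by apply: (frameK chiA x y).
have cffr v : cf (fr v) = h *: v by apply: coframeK.
have dgdet : \det dg = c by rewrite det_mx2 /dgf /= mulr0 subr0 mulr1.
have d1 := det_summand_mx_local (mk_linear Tl) rK frcf cffr.
have d2 := det_summand_mx_local (mk_linear taul) rK frcf cffr.
rewrite (mx_of_uniq (A := (c * h * h)%:M)) in d1; last first.
  by move=> v; rewrite mul_scalar_mx -[mk_linear Tl _]/((c * h) *: fr v) linearZ
    cffr /= scalerA.
rewrite (mx_of_uniq (A := (h * h) *: dg)) in d2; last first.
  move=> v; rewrite -scalemxAl -[mk_linear taul _]/(fr (dg *m cf (fr v))).
  by rewrite !cffr -scalemxAr scalerA.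
rewrite det_scalar in d1; rewrite detZ dgdet in d2.
have detE : \det E1 * pf = \det E2.
  rewrite /pf -pfaffian_pull.
  have -> : \matrix_(k, l) F (E1 *m delta_mx k 0) (E1 *m delta_mx l 0) =
      \matrix_(k, l) mxform (psi n.+1) (E2 *m delta_mx k 0) (E2 *m delta_mx l
        0).
    by apply/matrixP => k l; rewrite [LHS]mxE [RHS]mxE FE1.
  rewrite pfaffian_pull; have -> : \matrix_(k, l)
      mxform (@psi R n.+1) (delta_mx k 0) (delta_mx l 0) = psi_mx n.+1.
    apply/matrixP => k l; rewrite [LHS]mxE -[LHS]/(mxform_fun _ _ _)
      /mxform_fun.
    by rewrite trmx_delta -rowE -colE !mxE.
  by rewrite pfaffian_psi mulr1.
rewrite det_mulmx det_lower_mx !det_upper_mx det1 !mul1r dgdet in detE.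
exists 2%N, (n.*2 + 4)%N.
(* Multiplied by h^(2n+2), both determinants become c^2 h^(2n+4). *)
transitivity (h ^+ n.*2 * (c * h * h) ^+ 2 * pf
  - h ^+ n.*2 * ((h * h) ^+ 2 * c) * c); first by rewrite exprD; ring.
by rewrite -d1 -d2 -!mulrA detE [_ * c]mulrC subrr.
Qed.

(** The values of a at (0, 1) and (e_1, 1) generate the unit ideal, as
    1 = a(e) = a(e_1, 1) + (e_2 - 1) a(0, 1). *)
Lemma symbol_pfaffian : pf = 1.
Proof.
apply/eqP; rewrite -subr_eq0; apply/eqP.
suff : forall x y, exists m, chi x y ^+ m * (pf - 1) = 0.
  by move: (pf - 1) => w /(area_local chiA (X := R^o)).
move=> x y; have [k0 [m0 E0]] := symbol_pfaffian_local 0 x y.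
have [k1 [m1 E1]] := symbol_pfaffian_local e.1 x y.
have unit1 : a (e.1, 1) + (e.2 - 1) * a top = 1.
  have -> : a (e.1, 1) = a (e.1, 0) + a top.
    by rewrite -linearD; congr (a _); rewrite -[RHS]/(e.1 + 0, 0 + 1) addr0
      add0r.
  by rewrite -addrA mulrBl mul1r [X in _ + X]addrC subrK -linearZ -linearD
    -prod_split.
exists (m0 + m1)%N; move: E0 E1; move: (pf - 1) => w E0 E1.
rewrite -[LHS]mul1r -(expr1n _ (k1 + k0)) -unit1.
apply: (scaler_expD_eq0 (X := R^o)).
  transitivity (chi x y ^+ m0 * (a (e.1, 1) ^+ k1 * chi x y ^+ m1 * w)).
    rewrite exprD -[LHS]/(a (e.1, 1) ^+ k1 * (chi x y ^+ m0 * chi x y ^+ m1 *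
      w)).
    ring.
  by rewrite E1 mulr0.
transitivity ((e.2 - 1) ^+ k0 * chi x y ^+ m1 * (a top ^+ k0 * chi x y ^+ m0 *
  w)).
  rewrite exprMn exprD -[LHS]/((e.2 - 1) ^+ k0 * a top ^+ k0 *
    (chi x y ^+ m0 * chi x y ^+ m1 * w)).
  by move: ((e.2 - 1) ^+ k0); rewrite /GRing.regular => d; ring.
by rewrite E0 mulr0.
Qed.
End SymbolPfaffian.

(** * The symbol *)

Lemma VSL_class_ext (R : comPzRingType) (P : lmodType R) (hP : fg_projective P)
    (f0 f0' f1 f1' : altform P) :
  (forall p q, f0 p q = f0' p q) -> (forall p q, f1 p q = f1' p q) ->
  VSL_class (Triple hP f0 f1) = VSL_class (Triple hP f0' f1').
Proof.
move=> E0 E1; apply: VSL_class_isometric.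
by exists idfun; split=> //; exists idfun.
Qed.

Section Symbol.
Context {R : comPzRingType} {P : lmodType R} (chi : altform P).
Hypothesis chiA : area_form chi.
Local Notation N := (P * R^o)%type.
Local Notation M := (P * (R^o * R^o))%type.

(** Stabilize by the complement of P in R^2n: the first form becomes psi, and
    the second one has Pfaffian 1 by [symbol_pfaffian]. *)
Lemma symbol_in_VSL_tilde (a : {scalar N}) e (f : altform M)
    (hM : fg_projective M) :
  a e = 1 -> (forall m m', f m m' = symbol_form chi a e m m') ->
  in_VSL_tilde (VSL_class (Triple hM (perp chi psi2) f)).
Proof.
move=> ae fE; have [n [i iE]] := symplectic_embedding chiA.
have [r rE] := form_adjoint chi (mxform (psi n)) i.
have rK := adjointK iE rE.
pose g := complement iE rE.
have hQ := complement_fg_projective iE rE (cV_fg_projective n.*2).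
have omega_lin : linear (fun w : 'cV[R]_(n.+1.*2) =>
    (split_off r w, ker_part iE rE (tail2 w)) : (M * lin_ker r)%type).
  move=> c u v; congr (_, _).
    by rewrite /split_off head2_is_linear tail2_is_linear linearP !mxE.
  by rewrite tail2_is_linear ker_part_is_linear.
pose omega := mk_linear omega_lin.
have omega_bij : bijective omega.
  exists (fun x => pack (col2 x.1.2.1 x.1.2.2) (i x.1.1 + lin_ker_val x.2)).
    move=> w; rewrite -[RHS]packK /=; congr pack; last by rewrite addrC subrK.
    by apply/colP => j; rewrite [LHS]mxE; case: (ord2E j) => ->.
  move=> [[p [u v]] q]; rewrite /= /split_off pack_head2 pack_tail2.
  rewrite linearD rK lin_ker_val0 addr0 ![col2 _ _ _ _]mxE /=; congr (_, _).
  apply: val_inj; rewrite /= linearD rK lin_ker_val0 addr0.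
  by rewrite addrC addKr.
pose F := pullback omega_bij (perp f g).
have [m [mE mF]] := altform_mx F.
exists n.+1, m; split.
  rewrite mE; apply: (symbol_pfaffian chiA iE rE ae) => w w'.
  by rewrite -fE.
rewrite (VSL_class_stable hM hQ _ _ g); apply/esym/VSL_class_isometric.
exists omega; split=> [//|w w'|w w']; last exact: mF.
rewrite -[LHS]/(mxform (psi n.+1) w w') -{1}[w]packK -{1}[w']packK mxform_psiS.
have split_ v : v = i (r v) + (v - i (r v)) by rewrite addrC subrK.
rewrite [tail2 w in LHS]split_ [tail2 w' in LHS]split_ (psi_sum iE rE).
by rewrite addrA [plane_form _ _ + _]addrC.
Qed.

(** The two symbol forms correspond under the automorphism [SL_ext], which
    combines phi (+) 1 with the transvection from e to phi(e'). *)
Lemma symbol_SL_invariant (phi : SL N) (a : {scalar N}) e e' (f f' : altform M)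
    (hM : fg_projective M) :
  a e = 1 -> a (phi e') = 1 ->
  (forall m m', f m m' = symbol_form chi a e m m') ->
  (forall m m', f' m m' = symbol_form chi (fun x => a (phi x)) e' m m') ->
  VSL_class (Triple hM (perp chi psi2) f) =
  VSL_class (Triple hM (perp chi psi2) f').
Proof.
move=> ae ae' fE f'E; pose k := phi e' - e.
have ll : scalar (fun x => vol chi e (phi x) k).
  have [vl vc _] := vol_alt3 chiA.
  by move=> c u v; rewrite !(vc e) linearP vl.
rewrite (VSL_class_SL hM _ _ (SL_ext phi (mk_scalar ll))).
apply: VSL_class_ext => // m m'.
rewrite f'E (symbol_form_pull _ _ _ _ (vol_SL chiA phi)).
rewrite (symbol_form_change_section chiA (l := fun x => vol chi e x k) _ _ ae)
  // -fE /=.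
by rewrite -!surjective_pairing.
Qed.
End Symbol.

Lemma SL_identity (R : comPzRingType) (P : lmodType R) :
  fg_projective P -> exists phi : SL P, forall p, phi p = p.
Proof.
move=> [[n [g gs]] Pproj]; have [i iK] := Pproj _ _ g idfun gs.
have idB : bijective (idfun : P -> P) by exists idfun.
have idD : is_det (idfun : P -> P) 1.
  exists n, i, g; split=> //; rewrite -[LHS](det1 R n); congr (\det _).
  by apply/matrixP => k l; rewrite !mxE addrC subrK eqxx andbT.
by exists (MkSL (SL_fun := idfun) idB idD).
Qed.

Section VasersteinSymbol.
Context {R : comPzRingType} {P : lmodType R} (hP : fg_projective P).
Context (theta0 : {linear R^o -> ext 2 P}) (chi : altform P).
Hypothesis chiA : area_form chi.
Hypothesis theta0E : forall p q, theta0 (chi p q) = wedge2 p q.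
Hypothesis theta0_bij : bijective theta0.
Local Notation N := (P * R^o)%type.
Local Notation M := (P * (R^o * R^o))%type.
Local Notation hM := (prod_fg_projective hP
  (prod_fg_projective regular_fg_projective regular_fg_projective)).

(** The data in the definition of the symbol enter only through e = s(1). *)
Lemma is_vasersteinP (a : Um N) v : is_vaserstein hP theta0 a v ->
  exists (e : N) (f : altform M),
    [/\ a e = 1, forall m m', f m m' = symbol_form chi a e m m'
      & sval v = VSL_class (Triple hM (perp chi psi2) f)].
Proof.
move=> [s [aK [theta [chi0 [chi_a [_ wE chi0E thetaE ->]]]]]].
have chi0chi p q : chi0 p q = chi p q.
  by apply: (bij_inj theta0_bij); rewrite chi0E theta0E.
exists (s 1), (pullback (i_s1_bij aK) (perp chi_a psi2)); split=> //.
  move=> m m'; apply: (pullback_symbol_form chiA aK) => p q.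
  exact: (kernel_area_unique chiA theta0E wE thetaE).
by apply: VSL_class_ext => // m m'; rewrite /= /perp_fun chi0chi.
Qed.

Lemma is_vaserstein_ex (a : Um N) : exists v, is_vaserstein hP theta0 a v.
Proof.
have [e ae] := Um_surj a 1.
have [theta [theta_bij thetaE wE]] := kernel_trivialization chiA ae.
have sl : linear (fun r : R^o => r *: e).
  by move=> c u v; rewrite scalerDl scalerA.
have aK : cancel (mk_linear sl) a.
  by move=> c; rewrite /= linearZ /= ae mulr1.
have [chi_a' [chi_aE chi_aA]] := det_trivialization_area theta_bij.
have [chi_a chi_aF] := area_altform chi_aA.
have s1 : mk_linear sl 1 = e by rewrite /= scale1r.
have tE p q : theta (chi_a p q) = wedge2 p q by rewrite chi_aF.
have chi_vol p q : chi_a p q = vol chi (ker_val p) (ker_val q) (mk_linear sl 1).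
  by apply: (bij_inj theta_bij); rewrite s1 thetaE.
pose f := pullback (i_s1_bij aK) (perp chi_a psi2).
have fE m m' : f m m' = symbol_form chi a e m m'.
  by rewrite (pullback_symbol_form chiA aK _ _ chi_vol) s1.
exists (exist _ _ (symbol_in_VSL_tilde chiA hM ae fE)), (mk_linear sl), aK,
  theta, chi, chi_a.
by split=> // r; rewrite s1; apply: wE.
Qed.

Lemma is_vaserstein_SL (phi : SL N) (a : Um N) v v' :
  is_vaserstein hP theta0 a v -> is_vaserstein hP theta0 (Um_act a phi) v' ->
  v = v'.
Proof.
move=> /is_vasersteinP[e [f [ae fE vE]]] /is_vasersteinP[e' [f' [ae' f'E v'E]]].
case: v v' vE v'E => [v hv] [v' hv'] /= vE v'E; apply: eq_exist.
rewrite vE v'E; exact: (symbol_SL_invariant chiA hM ae ae' fE f'E).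
Qed.

Lemma is_vaserstein_uniq (a : Um N) v v' :
  is_vaserstein hP theta0 a v -> is_vaserstein hP theta0 a v' -> v = v'.
Proof.
have [phi phiE] := SL_identity (prod_fg_projective hP regular_fg_projective).
move=> /is_vasersteinP[e [f [ae fE vE]]] /is_vasersteinP[e' [f' [ae' f'E v'E]]].
case: v v' vE v'E => [v hv] [v' hv'] /= vE v'E; apply: eq_exist; rewrite vE v'E.
apply: (symbol_SL_invariant (phi := phi) (e' := e') chiA hM ae _ fE); first by
  rewrite phiE.
by move=> m m'; rewrite f'E /symbol_form !phiE.
Qed.
End VasersteinSymbol.

Theorem theorem3p1 (R : comPzRingType) (P0 : lmodType R)
    (hP0 : fg_projective P0) (rkP0 : constant_rank 2 P0)
    (theta0 : {linear R^o -> ext 2 P0}) (theta0_bij : bijective theta0) :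
  exists V : Um (P0 * R^o)%type -> VSL_tilde R,
    [/\ forall a v, is_vaserstein hP0 theta0 a v <-> v = V a,
        forall (phi : SL (P0 * R^o)%type) (a : Um (P0 * R^o)%type),
          V a = V (Um_act a phi)
      & exists Vbar : Um_mod_SL (P0 * R^o)%type -> VSL_tilde R,
          forall a, Vbar (Um_class a) = V a].
Proof.
have [chi' [chi'E chi'A]] := det_trivialization_area theta0_bij.
have [chi chiF] := area_altform chi'A.
have chiA : area_form chi.
  suff -> : (chi : P0 -> P0 -> R) = chi' by [].
  by apply/funext => p; apply/funext => q.
have theta0E p q : theta0 (chi p q) = wedge2 p q by rewrite chiF.
have /choice[V VE] : forall a, exists v, is_vaserstein hP0 theta0 a v.
  exact: (is_vaserstein_ex hP0 chiA theta0E).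
have VSL phi a : V a = V (Um_act a phi).
  exact: (is_vaserstein_SL chiA theta0E theta0_bij (VE a) (VE _)).
exists V; split=> // [a v|].
  split=> [va|->//]; exact: (is_vaserstein_uniq chiA theta0E theta0_bij va (VE
    a)).
have [phi _] := SL_identity (prod_fg_projective hP0 regular_fg_projective).
have /choice[Vbar VbarE] (O : Um_mod_SL (P0 * R^o)%type) :
    exists v, forall b, O = Um_class b -> v = V b.
  case: O => O [a OE]; exists (V a) => b /(congr1 sval) /= Ob.
  (* A point common to the orbits of a and b, whose symbols it shares. *)
  have : Um_orbit b (Um_act b phi) by exists phi.
  by rewrite -Ob OE (VSL phi b) => -[psi ->]; apply: VSL.
by exists Vbar => a; apply: VbarE.
Qed.
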